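(* Let $K$ be a field, $E$ a directed graph and $L=L_K(E)$. The following are equivalent. (1) Every proper ideal of $L$ is prime. (2) Every proper ideal of $L$ is a prime power. (3) Every ideal of $L$ is graded, and the ideals of $L$ form a chain under set inclusion. (4) The graph $E$ satisfies Condition (K), and the admissible pairs $(H,S)$ form a chain under the partial order of admissible pairs.
   Context: Graphs: $E=(E^0,E^1,r,s)$ with $E^0\neq\emptyset$, $r,s:E^1\to E^0$ range and source, no cardinality restrictions. A path is a finite sequence $e_1\cdots e_n$ of edges with $r(e_i)=s(e_{i+1})$; a closed path has $r(e_n)=s(e_1)$ and is based at $s(e_1)$. $E$ satisfies Condition (K) if every vertex lying on a closed path $\mu$ is also the base of a closed path $\gamma$ with a different set of edges from $\mu$. A vertex $v$ is regular if $s^{-1}(v)$ is finite nonempty, an infinite emitter if $s^{-1}(v)$ is infinite. $H\subseteq E^0$ is hereditary if whenever $u\in H$ and there is a path from $u$ to $v$ then $v\in H$; saturated if every regular $v$ with $r(s^{-1}(v))\subseteq H$ lies in $H$. The Leavitt path algebra $L_K(E)$ is the $K$-algebra generated by $\{v:v\in E^0\}\cup\{e,e^*:e\in E^1\}$ with relations $vw=\delta_{v,w}v$; $s(e)e=er(e)=e$; $r(e)e^*=e^*s(e)=e^*$; $e^*f=\delta_{e,f}r(e)$; $v=\sum_{e\in s^{-1}(v)}ee^*$ for regular $v$. It is $\mathbb Z$-graded with $\deg v=0$, $\deg e=1$, $\deg e^*=-1$; an ideal (always two-sided) is graded if it equals the direct sum of its intersections with the homogeneous components. For hereditary saturated $H$,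 the set $B_H$ of breaking vertices consists of infinite emitters $w\notin H$ with $0<|s^{-1}(w)\cap r^{-1}(E^0\setminus H)|<\infty$. An admissible pair is $(H,S)$ with $H$ hereditary saturated and $S\subseteq B_H$; the partial order is $(H_1,S_1)\le(H_2,S_2)$ iff $H_1\subseteq H_2$ and $S_1\subseteq H_2\cup S_2$. A proper ideal $P$ is prime if $AB\subseteq P$ for ideals $A,B$ implies $A\subseteq P$ or $B\subseteq P$; a prime power is an ideal $P^n$ with $P$ prime and $n$ a positive integer. *)

(* Defs.v *)
From mathcomp Require Import all_boot all_algebra.
From Stdlib Require Import ClassicalEpsilon.
Set Implicit Arguments. Unset Strict Implicit. Unset Printing Implicit Defensive.
Import GRing.Theory.
Local Open Scope ring_scope.

Record graph := Graph {
  vert : Type;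
  edge : Type;
  rng  : edge -> vert;
  src  : edge -> vert
}.

Definition pdec (P : Prop) : bool :=
  if excluded_middle_informative P then true else false.

Section Graphs.
Variable E : graph.

Fixpoint consec (p : seq (edge E)) : Prop :=
  match p with
  | e :: ((f :: _) as q) => rng e = src f /\ consec q
  | _ => True
  end.

Definition path_from_to (u v : vert E) : Prop :=
  u = v \/ exists (e : edge E) (p : seq (edge E)),
    consec (e :: p) /\ src e = u /\ rng (last e p) = v.

Definition closed_path (p : seq (edge E)) : Prop :=
  match p with
  | [::] => False
  | e :: q => consec p /\ rng (last e q) = src e
  end.

Definition based_at (p : seq (edge E)) (v : vert E) : Prop :=
  match p with [::] => False | e :: _ => src e = v end.

Definition lies_on (v : vert E) (p : seq (edge E)) : Prop :=
  exists e, List.In e p /\ src e = v.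

Definition same_edge_set (p q : seq (edge E)) : Prop :=
  forall e, List.In e p <-> List.In e q.

Definition condition_K : Prop :=
  forall (mu : seq (edge E)) (v : vert E), closed_path mu -> lies_on v mu ->
    exists gamma, closed_path gamma /\ based_at gamma v /\ ~ same_edge_set mu gamma.

Definition regular (v : vert E) : Prop :=
  exists l : seq (edge E), l <> [::] /\ forall e, src e = v <-> List.In e l.

Definition infinite_emitter (v : vert E) : Prop :=
  ~ exists l : seq (edge E), forall e, src e = v <-> List.In e l.

Definition hereditary (H : vert E -> Prop) : Prop :=
  forall u v, H u -> path_from_to u v -> H v.

Definition saturated (H : vert E -> Prop) : Prop :=
  forall v, regular v -> (forall e, src e = v -> H (rng e)) -> H v.

Definition breaking (H : vert E -> Prop) (w : vert E) : Prop :=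
  infinite_emitter w /\ ~ H w /\
  exists l : seq (edge E), l <> [::] /\
    forall e, (src e = w /\ ~ H (rng e)) <-> List.In e l.

Definition admissible (H S : vert E -> Prop) : Prop :=
  hereditary H /\ saturated H /\ (forall w, S w -> breaking H w).

Definition adm_le (H1 S1 H2 S2 : vert E -> Prop) : Prop :=
  (forall v, H1 v -> H2 v) /\ (forall v, S1 v -> H2 v \/ S2 v).

Definition admissible_chain : Prop :=
  forall H1 S1 H2 S2, admissible H1 S1 -> admissible H2 S2 ->
    adm_le H1 S1 H2 S2 \/ adm_le H2 S2 H1 S1.

End Graphs.

Section Leavitt.
Variables (K : fieldType) (E : graph).

Inductive gen := GV of vert E | GE of edge E | GS of edge E.
Definition word := seq gen.

(* elements of the free (unital) K-algebra on the generators are coefficient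
   functions on words with finite support; FA is the ambient space of all
   coefficient functions. *)
Definition FA := word -> K.

Definition fin_supp (f : FA) : Prop :=
  exists s : seq word, forall w, f w != 0 -> List.In w s.

(* elements of the free non-unital algebra: no constant term *)
Definition poly (f : FA) : Prop := fin_supp f /\ f [::] = 0.

Definition fa0 : FA := fun _ => 0.
Definition fa_add (f g : FA) : FA := fun w => f w + g w.
Definition fa_opp (f : FA) : FA := fun w => - f w.
Definition fa_sub (f g : FA) : FA := fa_add f (fa_opp g).
Definition fa_mul (f g : FA) : FA :=
  fun w => \sum_(i < (size w).+1) f (take i w) * g (drop i w).
Definition fa_sum (l : seq FA) : FA := foldr fa_add fa0 l.

Definition mono (w : word) : FA := fun u => if pdec (u = w) then 1 else 0.
Definition gv (v : vert E) : FA := mono [:: GV v].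
Definition ge (e : edge E) : FA := mono [:: GE e].
Definition gs (e : edge E) : FA := mono [:: GS e].

Inductive lpa_rel : FA -> Prop :=
  | rel_vv v : lpa_rel (fa_sub (fa_mul (gv v) (gv v)) (gv v))
  | rel_vw v w : v <> w -> lpa_rel (fa_mul (gv v) (gv w))
  | rel_se e : lpa_rel (fa_sub (fa_mul (gv (src e)) (ge e)) (ge e))
  | rel_er e : lpa_rel (fa_sub (fa_mul (ge e) (gv (rng e))) (ge e))
  | rel_rs e : lpa_rel (fa_sub (fa_mul (gv (rng e)) (gs e)) (gs e))
  | rel_ss e : lpa_rel (fa_sub (fa_mul (gs e) (gv (src e))) (gs e))
  | rel_ee e : lpa_rel (fa_sub (fa_mul (gs e) (ge e)) (gv (rng e)))
  | rel_ef e f : e <> f -> lpa_rel (fa_mul (gs e) (ge f))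
  | rel_ck v (l : seq (edge E)) : l <> [::] -> List.NoDup l ->
      (forall e, src e = v <-> List.In e l) ->
      lpa_rel (fa_sub (gv v) (fa_sum [seq fa_mul (ge e) (gs e) | e <- l])).

Inductive relI : FA -> Prop :=
  | relI0 : relI fa0
  | relI_gen a r b : fin_supp a -> fin_supp b -> lpa_rel r ->
      relI (fa_mul (fa_mul a r) b)
  | relI_add x y : relI x -> relI y -> relI (fa_add x y).

(* L_K(E) = {poly} / relI.  Subsets of L_K(E) are represented by
   saturated predicates on representatives. *)
Definition lpa_eq (x y : FA) : Prop := relI (fa_sub x y).

Definition is_ideal (J : FA -> Prop) : Prop :=
  (forall x, J x -> poly x) /\
  (forall x y, J x -> poly y -> lpa_eq x y -> J y) /\
  J fa0 /\
  (forall x y, J x -> J y -> J (fa_add x y)) /\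
  (forall x, J x -> J (fa_opp x)) /\
  (forall x a, J x -> poly a -> J (fa_mul a x) /\ J (fa_mul x a)).

Definition sub_ideal (A B : FA -> Prop) : Prop := forall x, A x -> B x.
Definition eq_ideal (A B : FA -> Prop) : Prop := forall x, A x <-> B x.

Definition proper (J : FA -> Prop) : Prop := exists x, poly x /\ ~ J x.

Definition ideal_prod (A B : FA -> Prop) : FA -> Prop :=
  fun x => poly x /\ exists l : seq (FA * FA),
    (forall p, List.In p l -> A p.1 /\ B p.2) /\
    lpa_eq x (fa_sum [seq fa_mul p.1 p.2 | p <- l]).

(* P^n for n >= 1 (P^0 is unused; set to the whole algebra) *)
Fixpoint ideal_pow (P : FA -> Prop) (n : nat) : FA -> Prop :=
  match n with
  | 0 => poly
  | 1 => P
  | m.+1 => ideal_prod (ideal_pow P m) P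
  end.

Definition prime_ideal (P : FA -> Prop) : Prop :=
  [/\ is_ideal P, proper P &
      forall A B, is_ideal A -> is_ideal B -> sub_ideal (ideal_prod A B) P ->
        sub_ideal A P \/ sub_ideal B P].

Definition prime_power (Q : FA -> Prop) : Prop :=
  exists (P : FA -> Prop) (n : nat),
    prime_ideal P /\ (0 < n)%N /\ eq_ideal Q (ideal_pow P n).

Definition gen_deg (g : gen) : int :=
  match g with GV _ => 0 | GE _ => 1 | GS _ => -1 end.
Definition word_deg (w : word) : int := \sum_(g <- w) gen_deg g.

Definition homogeneous (n : int) (y : FA) : Prop :=
  poly y /\ forall w, y w != 0 -> word_deg w = n.

Definition graded (J : FA -> Prop) : Prop :=
  forall x, J x -> exists l : seq (int * FA),
    (forall p, List.In p l -> J p.2 /\ homogeneous p.1 p.2) /\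
    lpa_eq x (fa_sum [seq p.2 | p <- l]).

Definition all_proper_prime : Prop :=
  forall J, is_ideal J -> proper J -> prime_ideal J.

Definition all_proper_prime_power : Prop :=
  forall J, is_ideal J -> proper J -> prime_power J.

Definition all_graded_chain : Prop :=
  (forall J, is_ideal J -> graded J) /\
  (forall A B, is_ideal A -> is_ideal B -> sub_ideal A B \/ sub_ideal B A).

End Leavitt.

Definition condK_admissible_chain (E : graph) : Prop :=
  condition_K E /\ admissible_chain E.

(* Main.v *)
(* Write L for the Leavitt path algebra.

   Under Condition (K), every ideal I of L is generated by the vertices H it
   contains and the gap elements w - sum_e e e^* it contains, where w is a breaking
   vertex of H and e ranges over the edges from w that leave H.  Indeed, modulo the graded ideal J
   generated by these, an element x of I is killed by induction on the length of
   its ghost paths: all the x e vanish, so x is y (w - sum_e e e^* ) with y a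
   combination of real paths, and compressing y by a path that is not eventually
   periodic leaves a vertex or a gap element of I.  As these generators are
   homogeneous idempotents, I is graded, I = I^2, and inclusion of ideals is the
   order of admissible pairs; this gives (4) => (1) and (4) => (3).

   Conversely, (1), (2) and (3) all imply that any two ideals A and B satisfy
   x^n in B for all x in A, or x^n in A for all x in B, for some n > 0.
   Annihilators of explicit representations on spaces of functions turn this into
   (4).  For the chain condition, represent L on the paths that avoid H, which may
   stop only at vertices that are not regular and not in S.  If (K) fails at v,
   a cycle c at v is the only way to return to v; represent L on the infinite
   paths ending in ccc... and twist c by an automorphism M.  Then v - c and
   v - c + c^2 show that M = 1 and M^2 - M + 1 = 0 give incomparable
   annihilators. *)
From HB Require Import structures.
Require Import Defs.
From mathcomp Require Import all_boot all_algebra.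
From mathcomp Require Import boolp.
From Stdlib Require Import ClassicalEpsilon.
Set Implicit Arguments. Unset Strict Implicit. Unset Printing Implicit Defensive.
Import GRing.Theory Defs.
Local Open Scope ring_scope.

(** * Classical equality on vertices, edges and generators *)

HB.instance Definition _ (E : graph) := gen_eqMixin (vert E).
HB.instance Definition _ (E : graph) := gen_eqMixin (edge E).
HB.instance Definition _ (E : graph) := gen_eqMixin (gen E).
HB.instance Definition _ (K : fieldType) (E : graph) := gen_eqMixin (FA K E).
HB.instance Definition _ (K : fieldType) (E : graph) := gen_choiceMixin (FA K E).

Lemma pdecE (P : Prop) : pdec P = `[< P >].
Proof.
rewrite /pdec; case: excluded_middle_informative => HP.
  by symmetry; apply/asboolP.
by symmetry; apply/asboolP.
Qed.

Lemma In_mem (T : eqType) (x : T) (s : seq T) : List.In x s <-> x \in s.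
Proof.
elim: s => [|y s IH] /=; first by [].
rewrite inE; split=> [[->|/IH ->]|/orP[/eqP ->|/IH]]; rewrite ?eqxx ?orbT //; by [left | right].
Qed.

Lemma NoDup_uniq (T : eqType) (s : seq T) : List.NoDup s <-> uniq s.
Proof.
elim: s => [|y s IH] /=; first by split=> // _; constructor.
split=> [H|/andP[ys us]].
  by inversion_clear H; apply/andP; split; [apply/negP => /In_mem | apply/IH].
by constructor; [move/In_mem; apply/negP | apply/IH].
Qed.

(** * The free unital algebra as a convolution algebra of functions on words *)

Section FreeAlgebra.
Variables (K : fieldType) (E : graph).
Local Notation FA := (FA K E).
Local Notation word := (word E).
Implicit Types (f g h : FA) (w u : word) (k : K).

Lemma fa_addA : associative (@fa_add K E).
Proof. by move=> f g h; apply/funext => w; rewrite /fa_add addrA. Qed.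
Lemma fa_addC : commutative (@fa_add K E).
Proof. by move=> f g; apply/funext => w; rewrite /fa_add addrC. Qed.
Lemma fa_add0 : left_id (@fa0 K E) (@fa_add K E).
Proof. by move=> f; apply/funext => w; rewrite /fa_add /fa0 add0r. Qed.
Lemma fa_addN : left_inverse (@fa0 K E) (@fa_opp K E) (@fa_add K E).
Proof. by move=> f; apply/funext => w; rewrite /fa_add /fa_opp addNr. Qed.
HB.instance Definition _ := GRing.isZmodule.Build FA fa_addA fa_addC fa_add0 fa_addN.

Lemma fa_addE f g w : (f + g) w = f w + g w. Proof. by []. Qed.
Lemma fa_oppE f w : (- f) w = - f w. Proof. by []. Qed.
Lemma fa_0E w : (0 : FA) w = 0. Proof. by []. Qed.

Definition fa_scale k f : FA := fun w => k * f w.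
Lemma fa_scaleA a b f : fa_scale a (fa_scale b f) = fa_scale (a * b) f.
Proof. by apply/funext => w; rewrite /fa_scale mulrA. Qed.
Lemma fa_scale1 : left_id 1 fa_scale.
Proof. by move=> f; apply/funext => w; rewrite /fa_scale mul1r. Qed.
Lemma fa_scaleDr : right_distributive fa_scale +%R.
Proof. by move=> k f g; apply/funext => w; rewrite /fa_scale !fa_addE mulrDr. Qed.
Lemma fa_scaleDl f : {morph fa_scale^~ f : a b / a + b}.
Proof. by move=> a b; apply/funext => w; rewrite /fa_scale !fa_addE mulrDl. Qed.
HB.instance Definition _ :=
  GRing.Zmodule_isLmodule.Build K FA fa_scaleA fa_scale1 fa_scaleDr fa_scaleDl.
Lemma fa_scaleE k f w : (k *: f) w = k * f w. Proof. by []. Qed.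

Lemma fa_mul_nil f g : fa_mul f g [::] = f [::] * g [::].
Proof. by rewrite /fa_mul big_ord_recl big_ord0 addr0. Qed.

(** The left derivative of a formal series by the letter [a]. It turns the convolution sum into a
    recursion on the word, on which associativity and the unit laws rest. *)
Definition deriv_at (a : gen E) f : FA := fun w => f (a :: w).

Lemma fa_mul_cons f g a w :
  fa_mul f g (a :: w) = f [::] * g (a :: w) + fa_mul (deriv_at a f) g w.
Proof. by rewrite /fa_mul /= big_ord_recl. Qed.

Lemma fa_mulDl : left_distributive (@fa_mul K E) +%R.
Proof.
move=> f g h; apply/funext => w; rewrite fa_addE /fa_mul -big_split.
by apply: eq_bigr => i _; rewrite mulrDl.
Qed.

Lemma fa_mulDr : right_distributive (@fa_mul K E) +%R.
Proof.
move=> f g h; apply/funext => w; rewrite fa_addE /fa_mul -big_split.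
by apply: eq_bigr => i _; rewrite mulrDr.
Qed.

Lemma fa_mulZl k f g : k *: (fa_mul f g) = fa_mul (k *: f) g.
Proof.
apply/funext => w; rewrite fa_scaleE /fa_mul mulr_sumr.
by apply: eq_bigr => i _; rewrite mulrA.
Qed.

Lemma fa_mulZr k f g : k *: (fa_mul f g) = fa_mul f (k *: g).
Proof.
apply/funext => w; rewrite fa_scaleE /fa_mul mulr_sumr.
by apply: eq_bigr => i _; rewrite fa_scaleE mulrCA.
Qed.

Lemma fa_mulA : associative (@fa_mul K E).
Proof.
move=> f g h; apply/funext => w; elim: w f g h => [|a w IH] f g h.
  by rewrite !fa_mul_nil mulrA.
rewrite !fa_mul_cons IH fa_mul_nil.
have -> : deriv_at a (fa_mul f g) = f [::] *: deriv_at a g + fa_mul (deriv_at a f) g.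
  by apply/funext => u; rewrite /deriv_at fa_mul_cons.
by rewrite fa_mulDl fa_addE -fa_mulZl fa_scaleE mulrDr addrA mulrA.
Qed.

Lemma mono_eq w u : mono K w u = (u == w)%:R.
Proof.
rewrite /mono pdecE; case: asboolP => [->|]; first by rewrite eqxx.
by move/eqP/negPf ->.
Qed.

Lemma fa_mul1 : left_id (mono K [::]) (@fa_mul K E).
Proof.
move=> f; apply/funext => -[|a w]; first by rewrite fa_mul_nil mono_eq mul1r.
rewrite fa_mul_cons mono_eq mul1r /fa_mul big1 ?addr0 // => i _.
by rewrite /deriv_at mono_eq mul0r.
Qed.

Lemma fa_mulr1 : right_id (mono K [::]) (@fa_mul K E).
Proof.
move=> f; apply/funext => w; elim: w f => [|a w IH] f.
  by rewrite fa_mul_nil mono_eq mulr1.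
by rewrite fa_mul_cons mono_eq mulr0 add0r IH.
Qed.

Lemma fa_1_neq0 : mono K [::] != 0 :> FA.
Proof.
apply/eqP => /(congr1 (fun f : FA => f [::])).
by rewrite mono_eq eqxx fa_0E => /eqP; rewrite oner_eq0.
Qed.

(** A word has finitely many factorisations, so convolution makes sense for all coefficient
    functions, even with infinite support. All of [FA] is therefore an algebra, and finite support
    is carried as a separate hypothesis. *)
HB.instance Definition _ := GRing.Zmodule_isNzRing.Build FA
  fa_mulA fa_mul1 fa_mulr1 fa_mulDl fa_mulDr fa_1_neq0.
HB.instance Definition _ := GRing.Lmodule_isLalgebra.Build K FA fa_mulZl.
HB.instance Definition _ := GRing.Lalgebra_isAlgebra.Build K FA fa_mulZr.

Lemma fa_mulE f g : fa_mul f g = f * g. Proof. by []. Qed.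
Lemma fa_subE f g : fa_sub f g = f - g. Proof. by []. Qed.
Lemma fa_sumE (l : seq FA) : fa_sum l = \sum_(f <- l) f.
Proof. by elim: l => [|f l IH] /=; rewrite ?big_nil // big_cons IH. Qed.

Lemma mono1 : mono K [::] = 1 :> FA. Proof. by []. Qed.

Lemma monoM w u : mono K (w ++ u) = mono K w * mono K u :> FA.
Proof.
apply/funext => z; elim: w z => [|a w IH] z; first by rewrite mono1 mul1r.
rewrite -fa_mulE; case: z => [|b z].
  by rewrite fa_mul_nil !mono_eq mul0r.
rewrite fa_mul_cons (mono_eq _ [::]) mul0r add0r /=.
have -> : deriv_at b (mono K (a :: w)) = (b == a)%:R *: mono K w.
  apply/funext => v; rewrite /deriv_at fa_scaleE !mono_eq eqseq_cons.
  by case: (b == a); rewrite ?mul1r ?mul0r.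
rewrite -fa_mulZl fa_scaleE fa_mulE -IH !mono_eq eqseq_cons.
by case: (b == a); rewrite ?mul1r ?mul0r.
Qed.

Lemma mono_cons a w : mono K (a :: w) = mono K [:: a] * mono K w :> FA.
Proof. by rewrite -monoM. Qed.

Lemma fin_suppP f : fin_supp f <-> exists2 s : seq word, uniq s & forall w, f w != 0 -> w \in s.
Proof.
split=> [[s Hs]|[s _ Hs]].
  by exists (undup s) => [|w /Hs/In_mem]; rewrite ?undup_uniq ?mem_undup.
by exists s => w /Hs /In_mem.
Qed.

Lemma fa_decomp f (s : seq word) : uniq s -> (forall w, f w != 0 -> w \in s) ->
  f = \sum_(w <- s) f w *: mono K w.
Proof.
move=> us Hs; apply/funext => u.
have sumE (F : word -> FA) : (\sum_(w <- s) F w) u = \sum_(w <- s) F w u.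
  by elim/big_rec2: _ => // w y1 y2 _ <-.
rewrite sumE; under eq_bigr do rewrite fa_scaleE mono_eq.
have [us'|] := boolP (u \in s).
  rewrite (big_rem u) //= eqxx mulr1 big_seq big1 ?addr0 // => w.
  by rewrite mem_rem_uniq // inE eq_sym => /andP[/negPf -> _]; rewrite mulr0.
move=> nus; rewrite big_seq big1 => [|w ws].
  by apply/eqP; apply: contraNT nus => /Hs.
by case: eqP => [e|_]; [rewrite e ws in nus | rewrite mulr0].
Qed.

Lemma fin0 : fin_supp (0 : FA).
Proof. by exists [::] => w; rewrite fa_0E eqxx. Qed.

Lemma finD f g : fin_supp f -> fin_supp g -> fin_supp (f + g).
Proof.
move=> [s Hs] [t Ht]; exists (s ++ t) => w; rewrite fa_addE => H.
apply/In_mem; rewrite mem_cat; apply: contraNT H; rewrite negb_or => /andP[ws wt].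
have /eqP -> : f w == 0 by apply: contraNT ws => /Hs /In_mem.
have /eqP -> : g w == 0 by apply: contraNT wt => /Ht /In_mem.
by rewrite addr0.
Qed.

Lemma finZ k f : fin_supp f -> fin_supp (k *: f).
Proof.
move=> [s Hs]; exists s => w H; apply: Hs; apply: contraNneq H => fw.
by rewrite fa_scaleE fw mulr0.
Qed.

Lemma finN f : fin_supp f -> fin_supp (- f).
Proof. by rewrite -scaleN1r; apply: finZ. Qed.

Lemma finB f g : fin_supp f -> fin_supp g -> fin_supp (f - g).
Proof. by move=> ff fg; apply: finD => //; apply: finN. Qed.

Lemma fin_mono w : fin_supp (mono K w : FA).
Proof. by exists [:: w] => u; rewrite mono_eq; case: (eqVneq u w) => [-> _|_ /eqP //]; left. Qed.

Lemma fin_sum I (r : seq I) (F : I -> FA) :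
  (forall i, fin_supp (F i)) -> fin_supp (\sum_(i <- r) F i).
Proof. by move=> H; elim/big_rec: _ => [|i x _]; [apply: fin0 | apply: finD]. Qed.

Lemma fin_ind (Pr : FA -> Prop) :
  Pr 0 -> (forall k w f, fin_supp f -> Pr f -> Pr (k *: mono K w + f)) ->
  forall f, fin_supp f -> Pr f.
Proof.
move=> P0 PD f /fin_suppP [s us Hs]; rewrite (fa_decomp us Hs).
elim: s {us Hs} => [|w s IH]; first by rewrite big_nil.
rewrite big_cons; apply: PD => //; apply: fin_sum => u; apply: finZ; exact: fin_mono.
Qed.

Lemma finM f g : fin_supp f -> fin_supp g -> fin_supp (f * g).
Proof.
move=> Hf Hg; elim/fin_ind: f / Hf => [|k w f Hf IHf]; first by rewrite mul0r; exact: fin0.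
rewrite mulrDl; apply: finD => //; rewrite -scalerAl; apply: finZ.
elim/fin_ind: g / Hg {IHf} => [|k' w' g Hg IHg]; first by rewrite mulr0; exact: fin0.
by rewrite mulrDr -scalerAr -monoM; apply: finD => //; apply: finZ; exact: fin_mono.
Qed.

Lemma poly0 : poly (0 : FA). Proof. by split=> //; exact: fin0. Qed.
Lemma polyD f g : poly f -> poly g -> poly (f + g).
Proof. by move=> [ff f0] [fg g0]; split; [exact: finD | rewrite fa_addE f0 g0 addr0]. Qed.
Lemma polyZ k f : poly f -> poly (k *: f).
Proof. by move=> [ff f0]; split; [exact: finZ | rewrite fa_scaleE f0 mulr0]. Qed.
Lemma polyN f : poly f -> poly (- f).
Proof. by rewrite -scaleN1r; exact: polyZ. Qed.
Lemma polyB f g : poly f -> poly g -> poly (f - g).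
Proof. by move=> pf pg; apply: polyD => //; exact: polyN. Qed.
Lemma polyMl f g : fin_supp f -> poly g -> poly (f * g).
Proof. by move=> ff [fg g0]; split; [exact: finM | rewrite -fa_mulE fa_mul_nil g0 mulr0]. Qed.
Lemma polyMr f g : poly f -> fin_supp g -> poly (f * g).
Proof. by move=> [ff f0] fg; split; [exact: finM | rewrite -fa_mulE fa_mul_nil f0 mul0r]. Qed.
Lemma poly_mono a w : poly (mono K (a :: w) : FA).
Proof. by split; [exact: fin_mono | rewrite mono_eq]. Qed.
Lemma poly_sum (I : Type) (r : seq I) (F : I -> FA) :
  (forall i, poly (F i)) -> poly (\sum_(i <- r) F i).
Proof. by move=> H; elim/big_rec: _ => [|i x _]; [exact: poly0 | exact: polyD]. Qed.

Lemma poly_rel f : lpa_rel f -> poly f.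
Proof.
have p1 (g : gen E) : poly (mono K [:: g] : FA) by exact: poly_mono.
have p2 (g h : gen E) : poly (fa_mul (mono K [:: g]) (mono K [:: h]) : FA).
  by apply: polyMl => //; case: (p1 g).
case=> *; do ?[exact: p1 | exact: p2 | apply: polyB].
rewrite fa_sumE big_map.
by apply: poly_sum => e; exact: p2.
Qed.

(** * Ideals spanned by generators *)

(** The multipliers [a] and [b] come from the unital free algebra, so a generator belongs to its
    ideal without any local unit. With [lpa_rel] as generators this is [relI]. *)
Inductive gen_ideal (G : FA -> Prop) : FA -> Prop :=
  | gen_ideal0 : gen_ideal G 0
  | gen_ideal_gen a g b : fin_supp a -> fin_supp b -> G g -> gen_ideal G (a * g * b)
  | gen_idealD x y : gen_ideal G x -> gen_ideal G y -> gen_ideal G (x + y).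

Lemma relIE f : relI f <-> gen_ideal (@lpa_rel K E) f.
Proof.
split; elim=> *; [exact: gen_ideal0 | exact: gen_ideal_gen | exact: gen_idealD |..].
- exact: relI0.
- exact: relI_gen.
- exact: relI_add.
Qed.

Section GenIdeal.
Variable G : FA -> Prop.
Hypothesis G_poly : forall g, G g -> poly g.

Lemma gen_idealZ k x : gen_ideal G x -> gen_ideal G (k *: x).
Proof.
elim=> [|a g b fa fb Gg|y z _ Hy _ Hz]; first by rewrite scaler0; exact: gen_ideal0.
  by rewrite !scalerAl; apply: gen_ideal_gen => //; exact: finZ.
by rewrite scalerDr; apply: gen_idealD.
Qed.

Lemma gen_idealM a b x : fin_supp a -> fin_supp b ->
  gen_ideal G x -> gen_ideal G (a * x * b).
Proof.
move=> fa fb; elim=> [|c g d fc fd Gg|y z _ Hy _ Hz]; first by rewrite mulr0 mul0r; exact: gen_ideal0.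
  have -> : a * (c * g * d) * b = (a * c) * g * (d * b) by rewrite !mulrA.
  by apply: gen_ideal_gen => //; exact: finM.
by rewrite mulrDr mulrDl; apply: gen_idealD.
Qed.

Lemma gen_ideal_poly x : gen_ideal G x -> poly x.
Proof.
elim=> [|a g b fa fb /G_poly pg|y z _ Hy _ Hz]; [exact: poly0 | | exact: polyD].
by apply: polyMr => //; exact: polyMl.
Qed.

Lemma gen_ideal_incl x : G x -> gen_ideal G x.
Proof. by move=> Gx; rewrite -[x]mul1r -[_ * _]mulr1; apply: gen_ideal_gen => //; exact: fin_mono. Qed.
End GenIdeal.

Lemma gen_idealS (G G' : FA -> Prop) x :
  (forall g, G g -> G' g) -> gen_ideal G x -> gen_ideal G' x.
Proof.
move=> GG'; elim=> [|a g b fa fb Gg|y z _ Hy _ Hz];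
  [exact: gen_ideal0 | by apply: gen_ideal_gen => //; exact: GG' |].
exact: gen_idealD.
Qed.

(** Ideals of the unital free algebra that contain the relations and consist of elements without
    constant term. The quotient is then a nonzero unital algebra, in which a quotient of L sits as
    the image of [poly]. *)
Record fideal := FIdeal {
  fcar :> FA -> Prop;
  fideal_poly : forall x, fcar x -> poly x;
  fideal_rel : forall x, relI x -> fcar x;
  fidealD : forall x y, fcar x -> fcar y -> fcar (x + y);
  fidealZ : forall k x, fcar x -> fcar (k *: x);
  fidealM : forall a b x, fin_supp a -> fin_supp b -> fcar x -> fcar (a * x * b)
}.

(** * The quotient algebra by such an ideal *)

Section Quotient.
Variable J : fideal.

Lemma fideal0 : J 0. Proof. by apply: fideal_rel; exact: relI0. Qed.
Lemma fidealN x : J x -> J (- x). Proof. by rewrite -scaleN1r; exact: fidealZ. Qed.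
Lemma fidealMl a x : fin_supp a -> J x -> J (a * x).
Proof. by move=> fa Jx; rewrite -[a * x]mulr1; apply: fidealM => //; exact: fin_mono. Qed.
Lemma fidealMr b x : fin_supp b -> J x -> J (x * b).
Proof. by move=> fa Jx; rewrite -[x]mul1r; apply: fidealM => //; exact: fin_mono. Qed.
(** A canonical representative modulo [J]. The choice operator depends only on the predicate, and
    congruent elements define the same predicate by extensionality; hence [qrepr_eq], and [quot] can
    be made of the fixed points of [qrepr]. *)
Definition qrepr f : FA :=
  epsilon (inhabits (0 : FA)) (fun g => fin_supp g /\ J (f - g)).

Lemma qreprP f : fin_supp f -> fin_supp (qrepr f) /\ J (f - qrepr f).
Proof.
move=> ff; apply: (epsilon_spec (inhabits (0 : FA)) (fun g => fin_supp g /\ J (f - g))).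
by exists f; rewrite subrr; split=> //; exact: fideal0.
Qed.

Lemma qrepr_eq f g : J (f - g) -> qrepr f = qrepr g.
Proof.
move=> Jfg; rewrite /qrepr; congr epsilon; apply/funext => h; apply/propext.
split=> -[fh Jh]; split=> //.
  have -> : g - h = - (f - g) + (f - h) by rewrite opprB addrA subrK.
  by apply: fidealD => //; exact: fidealN.
have -> : f - h = (f - g) + (g - h) by rewrite addrA subrK.
exact: fidealD.
Qed.

Record quot := Quot { qval : FA; qvalP : fin_supp qval /\ qrepr qval = qval }.
HB.instance Definition _ := gen_eqMixin quot.
HB.instance Definition _ := gen_choiceMixin quot.

(** Replaces functions of infinite support by 0, so that the projection [qpi] is total. *)
Definition fin_part f : FA := if `[< fin_supp f >] then f else 0.
Lemma fin_partP f : fin_supp (fin_part f).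
Proof. by rewrite /fin_part; case: asboolP => // _; exact: fin0. Qed.
Lemma fin_part_id f : fin_supp f -> fin_part f = f.
Proof. by move=> ff; rewrite /fin_part asboolT. Qed.

Lemma qrepr_quot f : fin_supp (qrepr (fin_part f)) /\
  qrepr (qrepr (fin_part f)) = qrepr (fin_part f).
Proof.
have [fr Jr] := qreprP (fin_partP f); split=> //.
by symmetry; exact: qrepr_eq.
Qed.
Definition qpi f : quot := Quot (qrepr_quot f).

Lemma qvalK : cancel qval qpi.
Proof.
move=> [x H]; have [fx ex] := H; rewrite /qpi; move: (qrepr_quot _) => /=.
by rewrite fin_part_id // ex => H'; congr Quot; exact: Prop_irrelevance.
Qed.

Lemma fin_qval q : fin_supp (qval q). Proof. by case: q => x []. Qed.

Lemma qpiP f g : fin_supp f -> fin_supp g -> qpi f = qpi g <-> J (f - g).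
Proof.
move=> ff fg; split=> [/(congr1 qval) /=|Jfg].
  rewrite !fin_part_id // => e.
  have -> : f - g = (f - qrepr f) - (g - qrepr g) by rewrite e opprB addrA subrK.
  apply: fidealD; [|apply: fidealN]; by apply: (qreprP _).2.
rewrite -[qpi f]qvalK -[qpi g]qvalK; congr qpi => /=.
by rewrite !fin_part_id //; exact: qrepr_eq.
Qed.

Lemma quot_ind (Pr : quot -> Prop) : (forall f, fin_supp f -> Pr (qpi f)) -> forall q, Pr q.
Proof. by move=> H q; rewrite -[q]qvalK; apply: H; exact: fin_qval. Qed.

Lemma qval_qpi f : fin_supp f -> J (qval (qpi f) - f).
Proof.
move=> ff; apply/qpiP => //; first exact: fin_qval.
by rewrite qvalK.
Qed.

Definition qadd x y := qpi (qval x + qval y).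
Definition qopp x := qpi (- qval x).
Definition qmul x y := qpi (qval x * qval y).
Definition qscale k x := qpi (k *: qval x).

Lemma qaddE f g : fin_supp f -> fin_supp g -> qadd (qpi f) (qpi g) = qpi (f + g).
Proof.
move=> ff fg; apply/qpiP; do ?[exact: finD]; first by apply: finD; exact: fin_qval.
by rewrite opprD addrACA; apply: fidealD; exact: qval_qpi.
Qed.

Lemma qoppE f : fin_supp f -> qopp (qpi f) = qpi (- f).
Proof.
move=> ff; apply/qpiP; do ?[exact: finN]; first by apply: finN; exact: fin_qval.
by rewrite -opprD; apply: fidealN; exact: qval_qpi.
Qed.

Lemma qscaleE k f : fin_supp f -> qscale k (qpi f) = qpi (k *: f).
Proof.
move=> ff; apply/qpiP; do ?[exact: finZ]; first by apply: finZ; exact: fin_qval.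
by rewrite -scalerBr; apply: fidealZ; exact: qval_qpi.
Qed.

Lemma qmulE f g : fin_supp f -> fin_supp g -> qmul (qpi f) (qpi g) = qpi (f * g).
Proof.
move=> ff fg; apply/qpiP; do ?[exact: finM]; first by apply: finM; exact: fin_qval.
have -> : qval (qpi f) * qval (qpi g) - f * g =
    (qval (qpi f) - f) * qval (qpi g) + f * (qval (qpi g) - g).
  by rewrite mulrBl mulrBr addrA subrK.
apply: fidealD; first by apply: fidealMr; [exact: fin_qval | exact: qval_qpi].
by apply: fidealMl => //; exact: qval_qpi.
Qed.

Lemma quot_surj x : exists2 f, fin_supp f & x = qpi f.
Proof. by exists (qval x); [exact: fin_qval | rewrite qvalK]. Qed.

Local Ltac qelim := repeat intro; repeat (match goal with x : quot |- _ =>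
    let f := fresh "f" in let ff := fresh "ff" in
    destruct (quot_surj x) as [f ff ->] end);
  rewrite ?(qaddE, qoppE, qmulE, qscaleE) //;
  try solve [do ?[apply: finD | apply: finM | apply: finZ | apply: finN | apply: fin0
    | apply: fin_mono | assumption]].

Lemma qaddA : associative qadd.
Proof. by qelim; rewrite addrA. Qed.
Lemma qaddC : commutative qadd.
Proof. by qelim; rewrite addrC. Qed.
Lemma qadd0 : left_id (qpi 0) qadd.
Proof. by qelim; rewrite add0r. Qed.
Lemma qaddN : left_inverse (qpi 0) qopp qadd.
Proof. by qelim; rewrite addNr. Qed.
HB.instance Definition _ := GRing.isZmodule.Build quot qaddA qaddC qadd0 qaddN.

Lemma qpiD f g : fin_supp f -> fin_supp g -> qpi (f + g) = qpi f + qpi g.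
Proof. by move=> ff fg; rewrite -qaddE. Qed.
Lemma qpiN f : fin_supp f -> qpi (- f) = - qpi f.
Proof. by move=> ff; rewrite -qoppE. Qed.
Lemma qpiB f g : fin_supp f -> fin_supp g -> qpi (f - g) = qpi f - qpi g.
Proof. by move=> ff fg; rewrite qpiD ?qpiN //; exact: finN. Qed.

Lemma qpi_eq0 f : fin_supp f -> qpi f = 0 <-> J f.
Proof. by move=> ff; rewrite -{2}[f]subr0; apply: qpiP => //; exact: fin0. Qed.

Lemma qmulA : associative qmul.
Proof. by qelim; rewrite mulrA. Qed.
Lemma qmul1 : left_id (qpi 1) qmul.
Proof. by move=> x; elim/quot_ind: x => f ff; rewrite qmulE ?mul1r //; exact: fin_mono. Qed.
Lemma qmulr1 : right_id (qpi 1) qmul.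
Proof. by move=> x; elim/quot_ind: x => f ff; rewrite qmulE ?mulr1 //; exact: fin_mono. Qed.
Lemma qmulDl : left_distributive qmul +%R.
Proof.
move=> x y z; elim/quot_ind: x => f ff; elim/quot_ind: y => g fg; elim/quot_ind: z => h fh.
by rewrite -qpiD // !qmulE ?mulrDl ?qpiD //; do ?[exact: finM | exact: finD].
Qed.
Lemma qmulDr : right_distributive qmul +%R.
Proof.
move=> x y z; elim/quot_ind: x => f ff; elim/quot_ind: y => g fg; elim/quot_ind: z => h fh.
by rewrite -qpiD // !qmulE ?mulrDr ?qpiD //; do ?[exact: finM | exact: finD].
Qed.
Lemma q1_neq0 : qpi 1 != 0.
Proof.
apply/eqP => /(qpi_eq0 (fin_mono _)) /fideal_poly [_].
by rewrite mono_eq eqxx => /eqP; rewrite oner_eq0.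
Qed.
HB.instance Definition _ := GRing.Zmodule_isNzRing.Build quot
  qmulA qmul1 qmulr1 qmulDl qmulDr q1_neq0.

Lemma qpiM f g : fin_supp f -> fin_supp g -> qpi (f * g) = qpi f * qpi g.
Proof. by move=> ff fg; rewrite -qmulE. Qed.

Lemma qscaleA a b x : qscale a (qscale b x) = qscale (a * b) x.
Proof. by elim/quot_ind: x => f ff; rewrite !qscaleE ?scalerA //; exact: finZ. Qed.
Lemma qscale1 : left_id 1 qscale.
Proof. by move=> x; elim/quot_ind: x => f ff; rewrite !qscaleE ?scale1r. Qed.
Lemma qscaleDr : right_distributive qscale +%R.
Proof.
move=> k x y; elim/quot_ind: x => f ff; elim/quot_ind: y => g fg.
by rewrite -qpiD // !qscaleE ?scalerDr ?qpiD //; do ?[exact: finZ | exact: finD].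
Qed.
Lemma qscaleDl x : {morph qscale^~ x : a b / a + b}.
Proof.
by move=> a b; elim/quot_ind: x => f ff; rewrite !qscaleE // scalerDl qpiD //; exact: finZ.
Qed.
HB.instance Definition _ :=
  GRing.Zmodule_isLmodule.Build K quot qscaleA qscale1 qscaleDr qscaleDl.

Lemma qpiZ k f : fin_supp f -> qpi (k *: f) = k *: qpi f.
Proof. by move=> ff; rewrite -qscaleE. Qed.

Lemma qscaleAl k (x y : quot) : k *: (x * y) = (k *: x) * y :> quot.
Proof.
elim/quot_ind: x => f ff; elim/quot_ind: y => g fg.
by rewrite -qpiM // -!qpiZ // -?qpiM ?scalerAl //; [exact: finZ | exact: finM].
Qed.
HB.instance Definition _ := GRing.Lmodule_isLalgebra.Build K quot qscaleAl.

Lemma qscaleAr k (x y : quot) : k *: (x * y) = x * (k *: y) :> quot.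
Proof.
elim/quot_ind: x => f ff; elim/quot_ind: y => g fg.
by rewrite -qpiM // -!qpiZ // -?qpiM ?scalerAr //; [exact: finZ | exact: finM].
Qed.
HB.instance Definition _ := GRing.Lalgebra_isAlgebra.Build K quot qscaleAr.

Lemma qpi_sum (I : Type) (r : seq I) (F : I -> FA) :
  (forall i, fin_supp (F i)) -> qpi (\sum_(i <- r) F i) = \sum_(i <- r) qpi (F i).
Proof.
move=> H; elim: r => [|i r IH]; first by rewrite !big_nil.
by rewrite !big_cons qpiD ?IH //; exact: fin_sum.
Qed.

End Quotient.
End FreeAlgebra.

(** * Walks and Condition (K) *)

Section Walks.
Variable E : graph.
Implicit Types (p q : seq (edge E)) (u v w : vert E) (e f : edge E).

Fixpoint walk u p w : Prop :=
  match p with [::] => u = w | e :: q => src e = u /\ walk (rng e) q w end.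

Lemma walk_cat u p q w : walk u (p ++ q) w <-> exists2 v, walk u p v & walk v q w.
Proof.
elim: p u => [|e p IH] u /=; first by split=> [|[v ->]] //; exists u.
split=> [[eu /IH[v pv qv]]|[v [eu pv] qv]]; first by exists v.
by split=> //; apply/IH; exists v.
Qed.

Lemma walk_consec e q : consec (e :: q) <-> walk (src e) (e :: q) (rng (last e q)).
Proof.
elim: q e => [|f q IH] e //=; split=> [[-> /IH[_ fq]]|[_ [<- fq]]] //.
by split=> //; apply/IH.
Qed.

Lemma walk_end u e q w : walk u (e :: q) w -> rng (last e q) = w.
Proof. by elim: q u e => [|f q IH] u e /= [_ //]; apply: (IH (rng e) f). Qed.

Lemma path_walk u v : path_from_to u v <-> exists p, walk u p v.
Proof.
split=> [[->|[e [p [/walk_consec ep [eu pv]]]]]|[[|e p]]]; first by exists [::].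
- by exists (e :: p); rewrite -eu -pv.
- by left.
- move=> H; right; exists e, p; case: (H) => eu _.
  by rewrite walk_consec (walk_end H) eu.
Qed.

Lemma closed_walk p v : p <> [::] -> walk v p v -> closed_path p /\ based_at p v.
Proof.
case: p => // e p _ H; case: (H) => eu _; rewrite /closed_path /based_at.
by rewrite walk_consec (walk_end H) eu.
Qed.

Lemma walk_closed p v : closed_path p -> based_at p v -> p <> [::] /\ walk v p v.
Proof. by case: p => // e p [/walk_consec H pe] <-; rewrite -{2}pe. Qed.

Lemma closed_rot p v : closed_path p -> lies_on v p ->
  exists q, [/\ q <> [::], walk v q v & same_edge_set p q].
Proof.
move=> cp [e [/In_mem ep ev]]; case/splitPr: ep cp => a b cp.
have [u pu] : exists u, walk u (a ++ e :: b) u.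
  have [u bu] : exists u, based_at (a ++ e :: b) u by case: (a) => [|c ?]; eexists.
  by exists u; case: (walk_closed cp bu).
case/walk_cat: pu => x ax [ex bu]; exists (e :: b ++ a); split=> //.
  by rewrite -cat_cons; apply/walk_cat; exists u; rewrite -?ev ?ex.
by move=> c; rewrite !In_mem mem_cat !inE mem_cat orbC -orbA.
Qed.

(** If s commutes with t, it commutes with every power of t. The power with exponent |s| is at least
    as long as s, so s is a prefix of it and uses only letters of t. *)
Lemma comm_cat_sub (T : eqType) (s t : seq T) : t <> [::] -> s ++ t = t ++ s ->
  {subset s <= t}.
Proof.
move=> t0 st; pose tk k := flatten (nseq k t).
have comm k : s ++ tk k = tk k ++ s.
  by elim: k => [|k IH]; rewrite /tk /= ?cats0 // catA st -!catA -IH.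
have size_tk k : (k <= size (tk k))%N.
  elim: k => // k IH; rewrite /tk /= size_cat -add1n leq_add //.
  by case: (t) t0.
have tk_sub k : {subset tk k <= t}.
  by elim: k => // k IH x; rewrite /tk /= mem_cat => /orP[|/IH].
move=> x xs; have /(congr1 (take (size s))) := comm (size s).
rewrite take_size_cat // takel_cat // => es; apply: (tk_sub (size s)).
by apply: (@mem_take (size s)); rewrite -es.
Qed.

(** Let q be a closed walk at [u] whose edge set differs from that of p. The walks p q and q p have
    equal length, and if they were equal, [comm_cat_sub] would make the two edge sets coincide. *)
Lemma condition_K_two_walks : condition_K E -> forall u p, p <> [::] -> walk u p u ->
  exists a b, [/\ a != b, size a = size b, walk u a u & walk u b u].
Proof.
move=> CK u p p0 pu; have [cp bp] := closed_walk p0 pu.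
have lp : lies_on u p by case: (p) p0 pu => // e q _ [eu _]; exists e; split; [left|].
have [q [cq [bq npq]]] := CK p u cp lp; have [q0 qu] := walk_closed cq bq.
exists (p ++ q), (q ++ p); split; try by apply/walk_cat; exists u.
  apply/eqP => pq; apply: npq => e; rewrite !In_mem.
  by split; [exact: comm_cat_sub pq _ | exact: comm_cat_sub (esym pq) _].
by rewrite !size_cat addnC.
Qed.

(** [prefix s (c ++ s)] says that s is an initial segment of c c c ..., and such a segment is
    determined by its length. The induction moves an index i back to i - |c|. *)
Lemma periodic_eq (T : eqType) (c s t : seq T) : c <> [::] -> size s = size t ->
  prefix s (c ++ s) -> prefix t (c ++ t) -> s = t.
Proof.
move=> c0 st /prefixP[s' es] /prefixP[t' et].
case: s => [|x0 s0] in st es *; first by case: (t) st.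
set s := x0 :: s0 in st es *.
apply: (@eq_from_nth _ x0) => // i; have [n] := ubnP i.
elim: n i => // n IH i /ltnSE i_n i_s.
have -> : nth x0 s i = nth x0 (c ++ s) i by rewrite es nth_cat i_s.
have -> : nth x0 t i = nth x0 (c ++ t) i by rewrite et nth_cat -st i_s.
rewrite !nth_cat; case: ltnP => // ci; apply: IH.
  by apply: leq_trans i_n; rewrite ltn_subrL (leq_trans _ ci) //; case: (c) c0.
by apply: leq_ltn_trans i_s; exact: leq_subr.
Qed.

(** A word that has left c c c ... stays off it however it is prolonged. *)
Lemma not_prefix_cat (T : eqType) (c s t : seq T) :
  ~~ prefix s (c ++ s) -> ~~ prefix (s ++ t) (c ++ (s ++ t)).
Proof.
apply: contraNN => /prefixP[r e]; apply/prefixP.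
have /(congr1 (take (size (c ++ s)))) := e.
rewrite catA take_size_cat // => ->; exists (drop (size s) (take (size (c ++ s)) ((s ++ t) ++ r))).
rewrite -{1}[LHS](cat_take_drop (size s)); congr (_ ++ _).
by rewrite take_takel ?size_cat ?leq_addl // -catA take_size_cat.
Qed.

(* The walks of the form d a and d b have equal length, and a cyclic word c is
   followed by only one word of each length, so one of them leaves c^oo. *)
Lemma nonperiodic_walk u a b : a != b -> size a = size b -> walk u a u -> walk u b u ->
  forall cs : seq (seq (edge E)), (forall c, c \in cs -> c <> [::]) ->
  exists2 d, walk u d u & forall c, c \in cs -> ~~ prefix d (c ++ d).
Proof.
move=> ab sab au bu; elim=> [|c cs IH] cs0; first by exists a.
have [|d du dcs] := IH; first by move=> x xcs; apply: cs0; rewrite inE xcs orbT.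
have c0 : c <> [::] by apply: cs0; rewrite mem_head.
have [pa|npa] := boolP (prefix (d ++ a) (c ++ (d ++ a))); last first.
  exists (d ++ a) => [|x]; first by apply/walk_cat; exists u.
  by rewrite inE => /orP[/eqP ->|/dcs] //; exact: not_prefix_cat.
exists (d ++ b) => [|x]; first by apply/walk_cat; exists u.
rewrite inE => /orP[/eqP ->|/dcs]; last exact: not_prefix_cat.
apply: contraNN ab => pb.
have /eqP : d ++ a = d ++ b by apply: (periodic_eq c0) pb => //; rewrite !size_cat sab.
by rewrite eqseq_cat // eqxx.
Qed.

End Walks.

(** * Leavitt families *)

(** The defining relations in an arbitrary unital algebra, so that one computation with paths serves
    every quotient of L. A vertex may be sent to zero. *)
Record leavitt_family (K : fieldType) (E : graph) (A : algType K)
    (P : vert E -> A) (X Y : edge E -> A) : Prop := LeavittFamily {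
  lf_vv : forall v, P v * P v = P v;
  lf_vw : forall v w, v <> w -> P v * P w = 0;
  lf_se : forall e, P (src e) * X e = X e;
  lf_er : forall e, X e * P (rng e) = X e;
  lf_rs : forall e, P (rng e) * Y e = Y e;
  lf_ss : forall e, Y e * P (src e) = Y e;
  lf_ee : forall e, Y e * X e = P (rng e);
  lf_ef : forall e f, e <> f -> Y e * X f = 0;
  lf_ck : forall v (l : seq (edge E)), l <> [::] -> uniq l ->
    (forall e, src e = v <-> e \in l) -> P v = \sum_(e <- l) X e * Y e
}.

Section Family.
Variables (K : fieldType) (E : graph) (A : algType K).
Variables (P : vert E -> A) (X Y : edge E -> A).
Hypothesis lf : leavitt_family P X Y.
Implicit Types (p q : seq (edge E)) (u v w : vert E) (e f : edge E).

Definition real_word p : A := foldr (fun e x => X e * x) 1 p.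
(** The product comes out in reverse order, e_n^* ... e_1^* for the path e_1 ... e_n, as it must for
    a ghost path. *)
Definition ghost_word p : A := foldr (fun e x => x * Y e) 1 p.
Local Notation Xs := real_word.
Local Notation Ys := ghost_word.

Lemma PXE u e : P u * X e = if u == src e then X e else 0.
Proof.
by case: eqP => [->|ne]; [rewrite (lf_se lf) | rewrite -(lf_se lf e) mulrA (lf_vw lf) ?mul0r].
Qed.
Lemma YPE u e : Y e * P u = if u == src e then Y e else 0.
Proof.
case: eqP => [->|ne]; first by rewrite (lf_ss lf).
by rewrite -(lf_ss lf e) -mulrA (lf_vw lf) ?mulr0 // => ue; exact: ne.
Qed.
Lemma YXE e f : Y e * X f = if e == f then P (rng f) else 0.
Proof. by case: eqP => [->|ne]; [rewrite (lf_ee lf) | rewrite (lf_ef lf)]. Qed.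
Lemma PPE u v : P u * P v = if u == v then P v else 0.
Proof. by case: eqP => [->|ne]; [rewrite (lf_vv lf) | rewrite (lf_vw lf)]. Qed.

Lemma Xs_cat p q : Xs (p ++ q) = Xs p * Xs q.
Proof. by elim: p => [|e p IH] /=; rewrite ?mul1r // IH mulrA. Qed.

Lemma PXsP_eq0 u p w : ~ walk u p w -> P u * Xs p * P w = 0.
Proof.
elim: p u => [|e p IH] u /=; first by move=> ?; rewrite mulr1 (lf_vw lf).
move=> nw; rewrite mulrA PXE; case: eqP => [ue|]; last by rewrite !mul0r.
rewrite -(lf_er lf e) -mulrA -(mulrA (X e)) [P _ * _]mulrA IH ?mulr0 // => rw.
by apply: nw.
Qed.

Lemma PXsP u p w : walk u p w -> P u * Xs p * P w = P u * Xs p.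
Proof.
elim: p u => [|e p IH] u /=; first by move=> ->; rewrite mulr1 (lf_vv lf).
move=> [<- rw]; rewrite mulrA (lf_se lf) // -(lf_er lf e) -!mulrA.
by congr (_ * _); rewrite mulrA IH.
Qed.

Lemma YsPXs u p w : walk u p w -> Ys p * P u * Xs p = P w.
Proof.
elim: p u => [|e p IH] u /=; first by move=> ->; rewrite mulr1 mul1r.
move=> [<- rw]; rewrite -(mulrA (Ys p)) (lf_ss lf) // mulrA -(mulrA (Ys p)) (lf_ee lf) //; exact: IH.
Qed.

Lemma YsPXs_eq0 u p q : (size p <= size q)%N -> ~~ prefix p q -> Ys p * P u * Xs q = 0.
Proof.
elim: p q u => [|e p IH] [|f q] u //= spq; rewrite negb_and => npq.
rewrite -(mulrA (Ys p)) YPE; case: eqP => _; last by rewrite mulr0 mul0r.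
rewrite mulrA -(mulrA (Ys p)) YXE; case: eqP => [ef|_]; last by rewrite mulr0 mul0r.
by apply: IH => //; move: npq; rewrite ef eqxx.
Qed.

(** Combinations of real paths with range [w]. Each term records coefficient, source and edges; the
    source gives meaning to trivial paths, and a triple that is not a walk to [w] contributes
    zero. *)
Definition real_sum w (l : seq (K * vert E * seq (edge E))) : A :=
  \sum_(t <- l) t.1.1 *: (P t.1.2 * Xs t.2 * P w).

Lemma real_sum_P w l : real_sum w l * P w = real_sum w l.
Proof.
rewrite /real_sum mulr_suml; apply: eq_bigr => t _.
by rewrite -scalerAl -[_ * P w * P w]mulrA (lf_vv lf).
Qed.

Lemma P_real_sum u w l : P u * real_sum w l = real_sum w [seq t <- l | t.1.2 == u].
Proof.
rewrite /real_sum mulr_sumr big_filter [RHS]big_mkcond; apply: eq_bigr => t _.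
rewrite -scalerAr !mulrA PPE eq_sym.
by case: eqP => [->|_]; rewrite ?mul0r ?scaler0.
Qed.

Lemma real_sum_unit w l :
  real_sum w l = \sum_(u <- undup [seq t.1.2 | t <- l]) P u * real_sum w l.
Proof.
rewrite -mulr_suml /real_sum mulr_sumr big_seq [RHS]big_seq; apply: eq_bigr => t tl.
rewrite -scalerAr !mulrA mulr_suml (bigD1_seq t.1.2) ?undup_uniq //=; last first.
  by rewrite mem_undup; apply/mapP; exists t.
rewrite (lf_vv lf) // big1 ?addr0 // => u /eqP ne; exact: (lf_vw lf).
Qed.

Definition behead_terms f (l : seq (K * vert E * seq (edge E))) :=
  [seq (t.1.1, rng f, behead t.2) | t <- l & (t.1.2 == src f) && (ohead t.2 == Some f)].

Lemma Y_real_sum f w l : (forall t, t \in l -> t.2 != [::]) ->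
  Y f * real_sum w l = real_sum w (behead_terms f l).
Proof.
move=> l0; rewrite /behead_terms /real_sum mulr_sumr big_map big_filter [RHS]big_mkcond.
rewrite big_seq [RHS]big_seq; apply: eq_bigr => -[[k u] [|e p]] /l0 //= _.
rewrite -scalerAr !mulrA YPE; case: eqP => _ /=; last by rewrite !mul0r scaler0.
rewrite YXE (inj_eq Some_inj) eq_sym.
by case: eqP => [->|_]; rewrite ?mul0r ?scaler0.
Qed.

(** A path with first edge f is fixed by the sum of the [X f * Y f] over all first edges that occur,
    so such a combination is recovered from its products with ghost edges. *)
Lemma real_sum_XY w l : (forall t, t \in l -> t.2 != [::]) ->
  (forall f, Y f * real_sum w l = 0) -> real_sum w l = 0.
Proof.
move=> l0 Y0; pose F := undup (pmap (fun t => ohead t.2) l).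
have <- : (\sum_(f <- F) X f * Y f) * real_sum w l = real_sum w l.
  rewrite /real_sum mulr_sumr big_seq [RHS]big_seq; apply: eq_bigr => -[[k u] [|e p]] tl.
    by have := l0 _ tl.
  rewrite -scalerAr /= !mulrA -(mulrA _ (P u)) PXE; case: eqP => [ue|_]; last first.
    by rewrite mulr0 !mul0r scaler0.
  congr (_ *: (_ * _ * _)).
  rewrite mulr_suml (bigD1_seq e) ?undup_uniq //=; last first.
    rewrite mem_undup mem_pmap; apply/mapP; exists (k, u, e :: p) => //.
  rewrite -mulrA (lf_ee lf) // (lf_er lf) // big1 ?addr0 // => f /eqP ne.
  by rewrite -mulrA (lf_ef lf) ?mulr0.
by rewrite mulr_suml big1 // => f _; rewrite -mulrA Y0 mulr0.
Qed.

(** Induction on the longest path. A vertex on the left selects the paths with one source u; ghost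
    edges then shorten them, and [real_sum_XY] concludes unless there is a constant term. [Z] will
    stand for an ideal, for vanishing after right multiplication by an edge, or for landing in an
    ideal after right multiplication by a gap element. *)
Lemma real_sum_reduction w (Z : A -> Prop) :
  (forall u z, Z z -> Z (P u * z)) -> (forall f z, Z z -> Z (Y f * z)) ->
  (forall k (l : seq (K * seq (edge E))), k != 0 -> (forall t, t \in l -> t.2 != [::]) ->
     Z (k *: P w + \sum_(t <- l) t.1 *: (P w * Xs t.2 * P w)) -> P w = 0) ->
  forall l, Z (real_sum w l) -> real_sum w l = 0.
Proof.
move=> ZP ZY Zw l; have [n] := ubnP (\max_(t <- l) size t.2).
elim: n l => // n IH l ln Zl.
rewrite real_sum_unit big_seq big1 // => u _; rewrite P_real_sum.
have := ZP u _ Zl; rewrite P_real_sum; set l' := filter _ l => Zl'.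
have l'u t : t \in l' -> t.1.2 = u by rewrite mem_filter => /andP[/eqP].
have l'n t : t \in l' -> (size t.2 <= n)%N.
  rewrite mem_filter => /andP[_ tl]; rewrite -ltnS; apply: leq_ltn_trans ln.
  by rewrite (big_rem t) //= leq_maxl.
move: l' Zl' l'u l'n => {ln Zl}l Zl lu ln.
pose l1 := [seq t <- l | t.2 != [::]].
pose k := \sum_(t <- l | t.2 == [::]) t.1.1.
have El : real_sum w l = k *: (P u * P w) + real_sum w l1.
  rewrite /real_sum (bigID (fun t => t.2 == [::])) /= /l1 big_filter; congr (_ + _).
  rewrite /k scaler_suml big_seq_cond [RHS]big_seq_cond; apply: eq_bigr => t.
  by case/andP=> /lu -> /eqP ->; rewrite mulr1.
have l1_0 t : t \in l1 -> t.2 != [::] by rewrite mem_filter => /andP[].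
have [Pw0|/eqP Pw0] := eqVneq (P w) 0; first by rewrite -real_sum_P Pw0 mulr0.
have Pu0 : k *: (P u * P w) = 0.
  (* A constant term survives only if u = w, and with a nonzero coefficient [Zw] would then give P w
     = 0. *)
  rewrite PPE; case: eqP => [uw|_]; last by rewrite scaler0.
  have [->|k0] := eqVneq k 0; first by rewrite scale0r.
  case: Pw0; apply: (Zw k [seq (t.1.1, t.2) | t <- l1]) => // [t /mapP[s sl ->]|].
    exact: l1_0.
  move: Zl; rewrite El uw (lf_vv lf) // /real_sum big_map /=; congr (Z (_ + _)).
  rewrite big_seq [RHS]big_seq; apply: eq_bigr => t.
  by rewrite mem_filter => /andP[_ /lu ->]; rewrite uw.
rewrite El Pu0 add0r in Zl *; case: n IH ln => [_ ln|n IH ln].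
  rewrite /real_sum big_seq big1 // => t tl1; have := l1_0 _ tl1.
  by move: tl1; rewrite mem_filter => /andP[_ /ln]; case: (t.2).
apply: real_sum_XY => // f.
rewrite Y_real_sum //; have := ZY f _ Zl; rewrite Y_real_sum //; apply: IH.
rewrite ltnS /behead_terms big_map big_seq_cond; apply/bigmax_leqP_seq => t.
rewrite mem_filter => /andP[_ tl1] _; rewrite size_behead.
move: (tl1); rewrite mem_filter => /andP[t0 /ln].
by case: (t.2) t0 => //= e p _; rewrite ltnS.
Qed.

(** * Spanning by the monomials p q^* *)

Definition lpa_sum (l : seq (K * vert E * seq (edge E) * seq (edge E) * vert E)) : A :=
  \sum_(t <- l) t.1.1.1.1 *: (P t.1.1.1.2 * Xs t.1.1.2 * (Ys t.1.2 * P t.2)).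

Definition spanned (z : A) : Prop := exists l, z = lpa_sum l.

Lemma spanned0 : spanned 0.
Proof. by exists [::]; rewrite /lpa_sum big_nil. Qed.

Lemma spannedD z t : spanned z -> spanned t -> spanned (z + t).
Proof. by move=> [l ->] [l' ->]; exists (l ++ l'); rewrite /lpa_sum big_cat. Qed.

Lemma spannedZ k z : spanned z -> spanned (k *: z).
Proof.
move=> [l ->]; exists [seq (k * t.1.1.1.1, t.1.1.1.2, t.1.1.2, t.1.2, t.2) | t <- l].
by rewrite /lpa_sum big_map scaler_sumr; apply: eq_bigr => t _; rewrite scalerA.
Qed.

Lemma spanned_term k u p q w : spanned (k *: (P u * Xs p * (Ys q * P w))).
Proof. by exists [:: (k, u, p, q, w)]; rewrite /lpa_sum big_seq1. Qed.

Lemma spannedMl a z :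
  (forall u p q w, spanned (a * (P u * Xs p * (Ys q * P w)))) ->
  spanned z -> spanned (a * z).
Proof.
move=> Ha [l ->]; rewrite /lpa_sum mulr_sumr.
elim/big_rec: _ => [|t y _ Hy]; first exact: spanned0.
by apply: spannedD Hy; rewrite -scalerAr; apply: spannedZ.
Qed.

Lemma spanned_mulP v z : spanned z -> spanned (P v * z).
Proof.
apply: spannedMl => u p q w; rewrite !mulrA PPE; case: eqP => _.
  by rewrite -(mulrA _ (Ys q)) -[_ * _]scale1r; exact: spanned_term.
by rewrite !mul0r; exact: spanned0.
Qed.

Lemma spanned_mulX e z : spanned z -> spanned (X e * z).
Proof.
apply: spannedMl => u p q w; rewrite !mulrA; have [->|ne] := eqVneq u (rng e).
  rewrite (lf_er lf); have := spanned_term 1 (src e) (e :: p) q w.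
  by rewrite scale1r /= !mulrA (lf_se lf).
rewrite -(lf_er lf) -(mulrA (X e)) PPE eq_sym (negPf ne) mulr0 !mul0r.
exact: spanned0.
Qed.

Lemma spanned_mulY e z : spanned z -> spanned (Y e * z).
Proof.
apply: spannedMl => u [|f p] q w; rewrite !mulrA YPE /=;
  case: eqP => _; try by rewrite !mul0r; exact: spanned0.
  have := spanned_term 1 (rng e) [::] (q ++ [:: e]) w; rewrite scale1r.
  have -> : Ys (q ++ [:: e]) = Y e * Ys q.
    by elim: (q) => [|f q' IH] /=; rewrite ?mulr1 ?mul1r // IH mulrA.
  by rewrite /= !mulr1 !mulrA (lf_rs lf).
rewrite YXE; case: eqP => _; last by rewrite !mul0r; exact: spanned0.
by rewrite -(mulrA _ (Ys q)) -[_ * _]scale1r; exact: spanned_term.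
Qed.

Lemma spanned_P v : spanned (P v).
Proof.
have := spanned_term 1 v [::] [::] v.
by rewrite scale1r /= mulr1 mul1r (lf_vv lf).
Qed.

Lemma spanned_X e : spanned (X e).
Proof.
have := spanned_term 1 (src e) [:: e] [::] (rng e).
by rewrite scale1r /= mulr1 mul1r (lf_se lf) (lf_er lf).
Qed.

Lemma spanned_Y e : spanned (Y e).
Proof.
have := spanned_term 1 (rng e) [::] [:: e] (src e).
by rewrite scale1r /= mulr1 mul1r (lf_ss lf) (lf_rs lf).
Qed.

Lemma lpa_sum_unit l :
  (\sum_(v <- undup [seq t.1.1.1.2 | t <- l]) P v) * lpa_sum l = lpa_sum l.
Proof.
rewrite /lpa_sum mulr_sumr big_seq [RHS]big_seq; apply: eq_bigr => t tl.
rewrite -scalerAr !mulrA mulr_suml (bigD1_seq t.1.1.1.2) ?undup_uniq //=; last first.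
  by rewrite mem_undup; apply/mapP; exists t.
by rewrite (lf_vv lf) big1 ?addr0 // => u /eqP ne; exact: (lf_vw lf).
Qed.

(** With s the sum of the e e^*, the relations give s s = s and w s = s w = s. *)
Lemma gap_idem w (l : seq (edge E)) : uniq l -> (forall e, e \in l -> src e = w) ->
  let g := P w - \sum_(e <- l) X e * Y e in g * g = g.
Proof.
move=> ul lw g; pose s := \sum_(e <- l) X e * Y e.
have Ps : P w * s = s.
  rewrite mulr_sumr big_seq [RHS]big_seq; apply: eq_bigr => e /lw <-.
  by rewrite mulrA (lf_se lf).
have sP : s * P w = s.
  rewrite mulr_suml big_seq [RHS]big_seq; apply: eq_bigr => e /lw <-.
  by rewrite -mulrA (lf_ss lf).
have ss : s * s = s.
  rewrite {1}/s mulr_suml big_seq [RHS]big_seq; apply: eq_bigr => e el.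
  rewrite mulr_sumr (bigD1_seq e) //= big1 => [|f /eqP ne]; last first.
    by rewrite mulrA -(mulrA _ (Y e)) (lf_ef lf) ?mulr0 ?mul0r // => ef; apply: ne.
  by rewrite addr0 mulrA -(mulrA _ (Y e)) (lf_ee lf) (lf_er lf).
by rewrite /g -/s mulrBl !mulrBr (lf_vv lf) Ps sP ss subrr subr0.
Qed.

(** * Reduction under Condition (K) for an ideal without nonzero vertices and gap elements *)

Section Reduction.
Variable I : A -> Prop.
Hypothesis IM : forall a b z, I z -> I (a * z * b).
Hypothesis IZ : forall k z, I z -> I (k *: z).
Hypothesis I_vert : forall v, I (P v) -> P v = 0.
Hypothesis I_gap : forall w (l : seq (edge E)), ~ regular w -> uniq l ->
  (forall e, e \in l <-> src e = w /\ P (rng e) <> 0) ->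
  I (P w - \sum_(e <- l) X e * Y e) -> P w - \sum_(e <- l) X e * Y e = 0.
Hypothesis P_graded : forall k u (l : seq (K * seq (edge E))), k != 0 ->
  (forall t, t \in l -> t.2 != [::]) ->
  k *: P u + \sum_(t <- l) t.1 *: (P u * Xs t.2) = 0 -> P u = 0.
Hypothesis CK : condition_K E.

Lemma I_scale_inv k z : k != 0 -> I (k *: z) -> I z.
Proof. by move=> k0 /(IZ k^-1); rewrite scalerA mulVf // scale1r. Qed.

Lemma IMl a z : I z -> I (a * z).
Proof. by move=> Iz; rewrite -[a * z]mulr1; exact: IM. Qed.
Lemma IMr b z : I z -> I (z * b).
Proof. by move=> Iz; rewrite -[z]mul1r; exact: IM. Qed.

(** If closed walks at w occur among the terms t, take a closed walk d at w that is an initial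
    segment of no t t t .... Then d^* t d = 0 while d^* w d = w, so compression by d leaves k w in
    [I]. *)
Lemma I_real_key w k (l : seq (K * seq (edge E))) : k != 0 ->
  (forall t, t \in l -> t.2 != [::]) ->
  I (k *: P w + \sum_(t <- l) t.1 *: (P w * Xs t.2 * P w)) -> P w = 0.
Proof.
move=> k0 l0 Iz.
have [[t [tl tw]]|nl] := EM (exists t, t \in l /\ walk w t.2 w); last first.
  apply: I_vert; apply: (I_scale_inv k0); move: Iz.
  rewrite big_seq big1 ?addr0 // => t tl; rewrite PXsP_eq0 ?scaler0 // => tw.
  by apply: nl; exists t.
have [a [b [ab sab aw bw]]] := condition_K_two_walks CK (elimN eqP (l0 _ tl)) tw.
have [|d dw dl] := @nonperiodic_walk E w a b ab sab aw bw [seq t.2 | t <- l].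
  by move=> c /mapP[s sl ->]; apply/eqP; exact: l0.
apply: I_vert; apply: (I_scale_inv k0).
have := IM (Ys d * P w) (P w * Xs d) Iz; congr I.
rewrite mulrDr mulrDl -scalerAr -scalerAl -(mulrA (Ys d) (P w) (P w)).
rewrite (lf_vv lf) (mulrA (Ys d * P w) (P w)) -(mulrA (Ys d) (P w) (P w)) (lf_vv lf).
rewrite (YsPXs dw) -[RHS]addr0; congr (_ + _).
rewrite mulr_sumr mulr_suml big_seq big1 // => s sl.
rewrite -scalerAr -scalerAl; have [sw|nsw] := EM (walk w s.2 w); last first.
  by rewrite PXsP_eq0 // mulr0 mul0r scaler0.
rewrite PXsP // mulrA -(mulrA _ _ (P w)) PXsP // -(mulrA (Ys d)) (mulrA (P w)) (lf_vv lf).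
rewrite -!mulrA -Xs_cat mulrA YsPXs_eq0 ?scaler0 //.
  by rewrite size_cat leq_addl.
by apply: dl; apply/mapP; exists s.
Qed.

Lemma I_real_eq0 w l : I (real_sum w l) -> real_sum w l = 0.
Proof.
apply: real_sum_reduction => [u z /IMl // | f z /IMl // | k l' k0 l0].
exact: I_real_key.
Qed.

Definition span_sum w (l : seq (K * vert E * seq (edge E) * seq (edge E))) : A :=
  \sum_(t <- l) t.1.1.1 *: (P t.1.1.2 * Xs t.1.2 * (Ys t.2 * P w)).

(** Compressing by the edge turns k w plus longer paths into k r(e) plus paths of positive length.
    Since r(e) is nonzero, [P_graded] forbids this to vanish, and [real_sum_reduction] applies. *)
Lemma real_sum_mulX w l e : src e = w -> P (rng e) <> 0 ->
  real_sum w l * X e = 0 -> real_sum w l = 0.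
Proof.
move=> ew Pe yX; apply: (@real_sum_reduction w (fun z => z * X e = 0)) => //.
- by move=> u z zX; rewrite -mulrA zX mulr0.
- by move=> f z zX; rewrite -mulrA zX mulr0.
move=> k l' k0 l0 /(congr1 (fun z => Y e * z)); rewrite mulr0 mulrA mulrDr mulrDl.
rewrite -scalerAr -scalerAl -(mulrA (Y e) (P w)) -ew (lf_se lf) (lf_ee lf) => H; case: Pe.
(* For a path t = e t', the product e^* t e is t' e, of positive length even when t' is empty. *)
apply: (@P_graded k (rng e) [seq (t.1, behead t.2 ++ [:: e]) | t <- l' & ohead t.2 == Some e]).
- done.
- by move=> t /mapP[s _ ->] /=; case: (behead _).
rewrite -[RHS]H; congr (_ + _); rewrite mulr_sumr mulr_suml big_map big_filter.
rewrite big_mkcond big_seq [RHS]big_seq; apply: eq_bigr => -[c [|f p]] /l0 //= _.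
rewrite -scalerAr -scalerAl !mulrA (lf_ss lf) YXE (inj_eq Some_inj) eq_sym.
case: eqP => [->|_]; last by rewrite !mul0r scaler0.
by rewrite -(mulrA _ (P _)) (lf_se lf) Xs_cat /= mulr1 !mulrA.
Qed.

(** Induction on the bound [n] for the ghost lengths: the products x e vanish by induction, which
    settles a regular w at once and otherwise reduces x to a real combination times a gap
    element. *)
Lemma span_sum_eq0 n w l : (forall t, t \in l -> (size t.2 <= n)%N) ->
  I (span_sum w l) -> span_sum w l = 0.
Proof.
elim: n w l => [|n IH] w l ln Ix.
  move: Ix; have -> : span_sum w l = real_sum w [seq t.1 | t <- l]; last exact: I_real_eq0.
  rewrite /span_sum /real_sum big_map big_seq [RHS]big_seq; apply: eq_bigr => t /ln.
  by rewrite leqn0 size_eq0 => /eqP -> /=; rewrite mul1r.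
set x := span_sum w l in Ix *.
pose y := real_sum w [seq t.1 | t <- l & t.2 == [::]].
pose l1 := [seq t <- l | t.2 != [::]].
have xE : x = y + span_sum w l1.
  rewrite /x /y /span_sum /real_sum (bigID (fun t => t.2 == [::])) /= big_map !big_filter.
  by congr (_ + _); apply: eq_bigr => t /eqP ->; rewrite /= mul1r.
have l1_0 t : t \in l1 -> t.2 != [::] by rewrite mem_filter => /andP[].
have xP : x * P w = x.
  rewrite /x /span_sum mulr_suml; apply: eq_bigr => t _.
  by rewrite -scalerAl -!mulrA (lf_vv lf).
have yP : y * P w = y by rewrite real_sum_P.
have l1X e : src e = w -> span_sum w l1 * X e =
    span_sum (rng e) [seq (t.1, behead t.2) | t <- l1 & ohead t.2 == Some e].
  move=> ew; rewrite /span_sum mulr_suml big_map [RHS]big_filter [RHS]big_mkcond.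
  rewrite big_seq [RHS]big_seq; apply: eq_bigr => -[[[k u] p] [|f q]] /l1_0 //= _.
  rewrite -scalerAl -!mulrA PXE ew eqxx YXE (inj_eq Some_inj).
  by case: eqP => _; rewrite ?mulr0 ?scaler0.
(* Multiplying by e lengthens the real terms and removes the first edge of each ghost path beginning
   with e, so the ghost lengths drop to at most n. *)
have xX e : x * X e = 0.
  have [ew|ne] := eqVneq (src e) w; last first.
    by rewrite -xP -mulrA PXE eq_sym (negPf ne) mulr0.
  have xXE : x * X e = span_sum (rng e) ([seq (t.1.1, t.1.2 ++ [:: e], [::]) | t <- l & t.2 == [::]]
      ++ [seq (t.1, behead t.2) | t <- l1 & ohead t.2 == Some e]).
    rewrite xE mulrDl l1X // /span_sum big_cat /=; congr (_ + _).
    rewrite /y /real_sum !big_map mulr_suml; apply: eq_bigr => t _ /=.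
    by rewrite -scalerAl mul1r Xs_cat /= mulr1 -!mulrA PXE ew eqxx (lf_er lf).
  rewrite xXE; apply: IH => [t|]; last by rewrite -xXE; exact: IMr.
  rewrite mem_cat => /orP[/mapP[s _ ->] //|/mapP[s]].
  rewrite !mem_filter => /andP[_ /andP[_ /ln]] sn -> /=.
  by rewrite size_behead; case: (size _) sn.
have [rw|nrw] := EM (regular w).
  (* A regular w is the sum of its e e^*, hence x = x w = 0. *)
  have [l2 [l20 /= Hl2]] := rw.
  rewrite -xP (@lf_ck _ _ _ _ _ _ lf w (undup l2)) ?undup_uniq // => [|e20|e].
  - by rewrite mulr_sumr big1 // => e _; rewrite mulrA xX mul0r.
  - case: l2 l20 e20 {Hl2} => // e l2 _ /(congr1 (fun s => e \in s)).
    by rewrite mem_undup mem_head.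
  - by rewrite mem_undup Hl2 In_mem.
(* The edges from w with which ghost paths of x begin; the sum of f f^* over them fixes the ghost
   part of x. *)
pose F := [seq f <- undup (pmap (fun t => ohead t.2) l1) | src f == w].
have x1E : span_sum w l1 = span_sum w l1 * \sum_(f <- F) X f * Y f.
  rewrite /span_sum mulr_suml big_seq [RHS]big_seq; apply: eq_bigr.
  move=> -[[[k u] p] [|f q]] tl1; first by have := l1_0 _ tl1.
  have YF : Y f * P w * (\sum_(g <- F) X g * Y g) = Y f * P w.
    rewrite YPE; case: eqP => [wf|_]; last by rewrite mul0r.
    rewrite (bigD1_seq f) ?filter_uniq ?undup_uniq //=; last first.
      rewrite mem_filter wf eqxx mem_undup mem_pmap; apply/mapP.
      by exists (k, u, p, f :: q).
    rewrite mulrDr mulrA (lf_ee lf) (lf_rs lf) mulr_sumr big1 ?addr0 // => g /eqP ne.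
    by rewrite mulrA (lf_ef lf) ?mul0r // => fg; apply: ne.
  by rewrite -scalerAl /= -!mulrA [Y f * (P w * _)]mulrA YF.
have xyE : x = y * (P w - \sum_(f <- F) X f * Y f).
  have : x * \sum_(f <- F) X f * Y f = 0.
    by rewrite mulr_sumr big1 // => f _; rewrite mulrA xX mul0r.
  rewrite {1}xE mulrDl -x1E => /eqP; rewrite addrC addr_eq0 => /eqP e.
  by rewrite xE e mulrBr yP.
(* An edge outside F kills the ghost part, so y e = x e = 0 and thus y = 0. *)
have [[e [ew Pe eF]]|nF] := EM (exists e, [/\ src e = w, P (rng e) <> 0 & e \notin F]).
  suff y0 : y = 0 by rewrite xyE y0 mul0r.
  apply: (real_sum_mulX ew Pe); have := xX e; rewrite xE mulrDl x1E -mulrA.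
  rewrite mulr_suml (eq_big_seq (fun=> 0)) ?big1 ?mulr0 ?addr0 // => f fF.
  by rewrite -mulrA YXE; case: eqP => [fe|_]; [rewrite -fe fF in eF | rewrite mulr0].
(* Edges with zero range contribute nothing; what remains is exactly the set of edges from w with
   nonzero range, as [I_gap] demands. *)
pose F0 := [seq f <- F | P (rng f) != 0].
have FE : \sum_(f <- F) X f * Y f = \sum_(f <- F0) X f * Y f.
  rewrite /F0 [RHS]big_filter [RHS]big_mkcond; apply: eq_bigr => f _.
  by case: eqP => // Pf; rewrite -(lf_er lf) Pf mulr0 mul0r.
have F0P e : e \in F0 <-> src e = w /\ P (rng e) <> 0.
  rewrite mem_filter; split=> [/andP[/eqP Pe]|[ew Pe]].
    by rewrite mem_filter => /andP[/eqP].
  apply/andP; split; first exact/eqP.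
  by apply/negP => /negP eF; apply: nF; exists e.
have uF0 : uniq F0 by rewrite !filter_uniq ?undup_uniq.
rewrite FE in xyE; set om := P w - _ in xyE.
have omX f : om * X f = 0.
  rewrite mulrBl PXE mulr_suml; case: eqP => [wf|nw]; last first.
    rewrite big_seq big1 ?subr0 // => g /F0P[gw _]; rewrite -mulrA YXE.
    by case: eqP => [gf|]; [rewrite -gf gw in nw | rewrite mulr0].
  have [fF0|nfF0] := boolP (f \in F0).
    rewrite (bigD1_seq f) //= -mulrA (lf_ee lf) (lf_er lf) big1 ?addr0 ?subrr // => g /eqP ne.
    by rewrite -mulrA (lf_ef lf) ?mulr0.
  rewrite big_seq big1 => [|g gF0]; last first.
    by rewrite -mulrA YXE; case: eqP => [gf|]; [rewrite -gf gF0 in nfF0 | rewrite mulr0].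
  rewrite subr0; have [Pf|/eqP Pf] := eqVneq (P (rng f)) 0.
    by rewrite -(lf_er lf) Pf mulr0.
  by case/negP: nfF0; apply/F0P.
have omP : om * P w = om.
  rewrite mulrBl (lf_vv lf) mulr_suml; congr (_ - _).
  rewrite big_seq [RHS]big_seq; apply: eq_bigr => f /F0P[fw _].
  by rewrite -mulrA YPE fw eqxx.
have Pom : P w * om = om.
  rewrite mulrBr (lf_vv lf) mulr_sumr; congr (_ - _).
  rewrite big_seq [RHS]big_seq; apply: eq_bigr => f /F0P[fw _].
  by rewrite mulrA PXE fw eqxx.
have omom : om * om = om.
  rewrite {2}/om mulrBr omP mulr_sumr big1 ?subr0 // => f _.
  by rewrite mulrA omX mul0r.
have I_om : I om -> om = 0 := I_gap nrw uF0 F0P.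
move: om xyE omX omP Pom omom I_om => om xyE omX omP Pom omom I_om.
have [om0|/eqP om0] := eqVneq om 0; first by rewrite xyE om0 mulr0.
rewrite xyE; suff -> : y = 0 by rewrite mul0r.
(* Since om f = 0 for every edge f, multiplying k w plus longer paths by om on both sides gives k
   om; a constant term would thus put om into [I]. *)
apply: (@real_sum_reduction w (fun z => I (z * om))); last by rewrite -/y -xyE.
- by move=> u z; rewrite -mulrA => /IMl.
- by move=> f z; rewrite -mulrA => /IMl.
move=> k l' k0 l0 /(IMl om) Iom; case: om0; apply: I_om.
apply: (I_scale_inv k0); move: Iom; congr I.
rewrite mulrDl mulrDr -scalerAl -scalerAr Pom omom -[RHS]addr0; congr (_ + _).
rewrite mulr_suml mulr_sumr big_seq big1 // => -[c [|f p]] /l0 //= _.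
rewrite -scalerAl -scalerAr !mulrA omP omX !mul0r; exact: scaler0.
Qed.

Theorem lpa_sum_eq0 l : I (lpa_sum l) -> lpa_sum l = 0.
Proof.
move=> Ix.
have xP w : lpa_sum l * P w = span_sum w [seq t.1 | t <- l & t.2 == w].
  rewrite /lpa_sum /span_sum big_map big_filter [RHS]big_mkcond mulr_suml.
  apply: eq_bigr => t _; rewrite -scalerAl -!mulrA PPE.
  by case: eqP => _; rewrite ?mulr0 ?scaler0.
have <- : lpa_sum l * \sum_(w <- undup [seq t.2 | t <- l]) P w = lpa_sum l.
  rewrite /lpa_sum mulr_suml big_seq [RHS]big_seq; apply: eq_bigr => t tl.
  rewrite -scalerAl -!mulrA (bigD1_seq t.2) ?undup_uniq //=; last first.
    by rewrite mem_undup; apply/mapP; exists t.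
  rewrite mulrDr (lf_vv lf) mulr_sumr big1 ?addr0 // => w /eqP ne.
  by rewrite (lf_vw lf) // => tw; apply: ne.
rewrite mulr_sumr big1 // => w _; rewrite xP.
apply: (@span_sum_eq0 (\max_(t <- l) size t.1.2)) => [t /mapP[s]|].
  by rewrite mem_filter => /andP[_ sl] ->; rewrite (big_rem s) //= leq_maxl.
by rewrite -xP; exact: IMr.
Qed.

End Reduction.
End Family.

(** * Quotients of the Leavitt path algebra *)

Section QuotientFamily.
Variables (K : fieldType) (E : graph).
Local Notation FA := (FA K E).
Implicit Types (e f : edge E) (v w : vert E) (x y : FA).

Lemma fin_gv v : fin_supp (gv K v). Proof. exact: fin_mono. Qed.
Lemma fin_ge e : fin_supp (ge K e). Proof. exact: fin_mono. Qed.
Lemma fin_gs e : fin_supp (gs K e). Proof. exact: fin_mono. Qed.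

Section Family.
Variable J : fideal K E.

Definition qP v : quot J := qpi J (gv K v).
Definition qX e : quot J := qpi J (ge K e).
Definition qY e : quot J := qpi J (gs K e).

Lemma qpi_rel x : lpa_rel x -> qpi J x = 0.
Proof.
move=> rx; apply/(qpi_eq0 J); first by case: (poly_rel rx).
by apply: fideal_rel; apply/relIE; exact: gen_ideal_incl.
Qed.

Lemma quot_family : leavitt_family qP qX qY.
Proof.
have fv := fin_gv; have fe := fin_ge; have fs := fin_gs.
have subE (x y z : FA) : fin_supp x -> fin_supp y -> fin_supp z ->
    lpa_rel (fa_sub (fa_mul x y) z) -> qpi J x * qpi J y = qpi J z.
  move=> fx fy fz /qpi_rel; rewrite fa_subE fa_mulE qpiB ?qpiM //; last exact: finM.
  by move/eqP; rewrite subr_eq0 => /eqP.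
have zeroE (x y : FA) : fin_supp x -> fin_supp y ->
    lpa_rel (fa_mul x y) -> qpi J x * qpi J y = 0.
  by move=> fx fy /qpi_rel; rewrite fa_mulE qpiM.
split=> [v|v w vw|e|e|e|e|e|e f ef|v l l0 ul Hl].
- by apply: subE => //; exact: rel_vv.
- by apply: zeroE => //; exact: rel_vw.
- by apply: subE => //; exact: rel_se.
- by apply: subE => //; exact: rel_er.
- by apply: subE => //; exact: rel_rs.
- by apply: subE => //; exact: rel_ss.
- by apply: subE => //; exact: rel_ee.
- by apply: zeroE => //; exact: rel_ef.
have lR : lpa_rel (fa_sub (gv K v) (fa_sum [seq fa_mul (ge K e) (gs K e) | e <- l])).
  by apply: rel_ck => //; [apply/NoDup_uniq | move=> e; rewrite In_mem].
have := qpi_rel lR; rewrite fa_subE fa_sumE big_map.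
have fXY e : fin_supp (fa_mul (ge K e) (gs K e)) by exact: finM.
rewrite qpiB //; last exact: fin_sum.
move/eqP; rewrite subr_eq0 => /eqP; rewrite qpi_sum // => Ev; rewrite /qP Ev.
by apply: eq_bigr => e _; rewrite fa_mulE qpiM.
Qed.

Local Notation Xs := (real_word qX).
Local Notation Ys := (ghost_word qY).

Lemma qpi_real p : qpi J (mono K (map (@GE E) p)) = Xs p.
Proof. by elim: p => // e p IH; rewrite map_cons mono_cons qpiM ?IH //; exact: fin_mono. Qed.

Lemma spanned_poly x : poly x -> spanned qP qX qY (qpi J x).
Proof.
have lf := quot_family; move=> [/fin_suppP [s us Hs] x0].
rewrite (fa_decomp us Hs) qpi_sum; last by move=> w; apply: finZ; exact: fin_mono.
rewrite (bigID (fun s0 : word E => s0 == [::])) /= big1 => [|w /eqP ->]; last by rewrite x0 scale0r.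
rewrite add0r; elim/big_rec: _ => [|[|g w] y // _ Hy]; first exact: spanned0.
apply: spannedD Hy; rewrite qpiZ; last exact: fin_mono.
apply: spannedZ; elim: w g => [[v|e|e]|h w IH g].
- exact: spanned_P lf v.
- exact: spanned_X lf e.
- exact: spanned_Y lf e.
rewrite mono_cons qpiM; [|exact: fin_mono|exact: fin_mono].
case: g => [v|e|e].
- exact: (spanned_mulP lf v (IH h)).
- exact: (spanned_mulX lf e (IH h)).
- exact: (spanned_mulY lf e (IH h)).
Qed.

End Family.

Definition rel_fideal : fideal K E :=
  FIdeal (gen_ideal_poly (@poly_rel K E)) (fun x => proj1 (relIE x))
    (@gen_idealD _ _ _) (@gen_idealZ _ _ _) (@gen_idealM _ _ _).

(** L need not have an identity, but when x is a combination of monomials p q^*, the sum of the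
    sources of the p is a left unit for x. This makes ideals stable under scalars. *)
Lemma local_unit x : poly x -> exists2 u, poly u & relI (u * x - x).
Proof.
move=> px; have [l El] := spanned_poly rel_fideal px.
have lf := quot_family rel_fideal.
pose V := undup [seq t.1.1.1.2 | t <- l].
have pu : poly (\sum_(v <- V) gv K v) by apply: poly_sum => v; exact: poly_mono.
exists (\sum_(v <- V) gv K v) => //; have [fu _] := pu; have [fx _] := px.
apply/relIE; apply/(qpi_eq0 rel_fideal); first by apply: finB => //; exact: finM.
rewrite qpiB ?qpiM //; last exact: finM.
rewrite El qpi_sum; last exact: fin_gv.
apply/eqP; rewrite subr_eq0; apply/eqP.
exact: (lpa_sum_unit lf).
Qed.

(** * Ideals of L as ideals of the unital free algebra *)

Section IdealOfLpa.
Variable I : FA -> Prop.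
Hypothesis idI : is_ideal I.

Lemma lpa_ideal_poly x : I x -> poly x. Proof. by case: idI => H _; exact: H. Qed.
Lemma lpa_ideal_eq x y : I x -> poly y -> relI (x - y) -> I y.
Proof. by case: idI => _ [H _]; exact: H. Qed.
Lemma lpa_ideal0 : I 0. Proof. by case: idI => _ [_ [H _]]. Qed.
Lemma lpa_idealD x y : I x -> I y -> I (x + y).
Proof. by case: idI => _ [_ [_ [H _]]]; exact: H. Qed.
Lemma lpa_idealN x : I x -> I (- x).
Proof. by case: idI => _ [_ [_ [_ [H _]]]]; exact: H. Qed.
Lemma lpa_idealMl x a : poly a -> I x -> I (a * x).
Proof. by case: idI => _ [_ [_ [_ [_ H]]]] pa Ix; case: (H x a Ix pa). Qed.
Lemma lpa_idealMr x a : poly a -> I x -> I (x * a).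
Proof. by case: idI => _ [_ [_ [_ [_ H]]]] pa Ix; case: (H x a Ix pa). Qed.

Lemma relIN (x : FA) : relI x -> relI (- x).
Proof. by move/relIE => H; apply/relIE; rewrite -scaleN1r; exact: gen_idealZ. Qed.

Lemma lpa_ideal_rel x : relI x -> I x.
Proof.
move=> rx; apply: (lpa_ideal_eq lpa_ideal0); last by rewrite sub0r; exact: relIN.
by move/relIE: rx => /gen_ideal_poly; apply; exact: poly_rel.
Qed.

Lemma lpa_idealZ k x : I x -> I (k *: x).
Proof.
move=> Ix; have px := lpa_ideal_poly Ix; have [u pu ru] := local_unit px.
apply: (@lpa_ideal_eq ((k *: u) * x)); [apply: lpa_idealMl => //; exact: polyZ | exact: polyZ |].
by rewrite -scalerAl -scalerBr; apply/relIE; apply: gen_idealZ; exact/relIE.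
Qed.

Lemma poly_part (a : FA) : fin_supp a -> poly (a - a [::] *: 1).
Proof.
move=> fa; split; first by apply: finB => //; apply: finZ; exact: fin_mono.
by rewrite fa_addE fa_oppE fa_scaleE -mono1 mono_eq eqxx mulr1 subrr.
Qed.

Lemma lpa_idealM a b x : fin_supp a -> fin_supp b -> I x -> I (a * x * b).
Proof.
move=> fa fb Ix; have Iax : I (a * x).
  rewrite -[a](subrK (a [::] *: 1)) mulrDl -scalerAl mul1r.
  by apply: lpa_idealD; [apply: lpa_idealMl => //; exact: poly_part | exact: lpa_idealZ].
rewrite -[b](subrK (b [::] *: 1)) mulrDr -scalerAr mulr1.
by apply: lpa_idealD; [apply: lpa_idealMr => //; exact: poly_part | exact: lpa_idealZ].
Qed.

Definition ideal_fideal : fideal K E :=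
  FIdeal lpa_ideal_poly lpa_ideal_rel lpa_idealD lpa_idealZ lpa_idealM.

Lemma gen_ideal_sub (G : FA -> Prop) x : (forall g, G g -> I g) -> gen_ideal G x -> I x.
Proof.
move=> GI; elim=> [|a g b fa fb /GI|y z _ Iy _ Iz];
  [exact: lpa_ideal0 | exact: lpa_idealM | exact: lpa_idealD].
Qed.

End IdealOfLpa.

End QuotientFamily.

(** * The grading *)

Section Grading.
Variables (K : fieldType) (E : graph).
Local Notation FA := (FA K E).
Local Notation word := (word E).
Implicit Types (f g : FA) (w u : word) (d : int).

Lemma word_degD w u : word_deg (w ++ u) = word_deg w + word_deg u.
Proof. by rewrite /word_deg big_cat. Qed.

Lemma word_deg_real (p : seq (edge E)) : word_deg (map (@GE E) p) = (size p)%:Z.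
Proof.
rewrite /word_deg big_map; elim: p => [|e p IH]; first by rewrite big_nil.
by rewrite big_cons IH /= -PoszD.
Qed.

Definition component d f : FA := fun w => if word_deg w == d then f w else 0.

Lemma componentD d f g : component d (f + g) = component d f + component d g.
Proof.
apply/funext => w; rewrite fa_addE /component fa_addE.
by case: eqP => // _; rewrite addr0.
Qed.

Lemma componentZ d k f : component d (k *: f) = k *: component d f.
Proof.
apply/funext => w; rewrite fa_scaleE /component fa_scaleE.
by case: eqP => // _; rewrite mulr0.
Qed.

Lemma component0 d : component d 0 = 0.
Proof. by apply/funext => w; rewrite /component fa_0E if_same. Qed.

Lemma component_sum d (I : Type) (r : seq I) (F : I -> FA) :
  component d (\sum_(i <- r) F i) = \sum_(i <- r) component d (F i).
Proof.
elim: r => [|i r IH]; first by rewrite !big_nil component0.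
by rewrite !big_cons componentD IH.
Qed.

Lemma component_homog d d' f : (forall w, f w != 0 -> word_deg w = d') ->
  component d f = if d' == d then f else 0.
Proof.
move=> Hf; apply/funext => w; rewrite /component.
have [fw|/Hf ->] := eqVneq (f w) 0; last by case: eqP.
by rewrite fw if_same; case: eqP.
Qed.

Lemma component_mono d w : component d (mono K w) = if word_deg w == d then mono K w else 0.
Proof.
apply: component_homog => u; rewrite mono_eq.
by case: (eqVneq w u) => [->|]; rewrite ?eqxx // eq_sym => /negPf ->; rewrite eqxx.
Qed.

Lemma homogM d d' f g : (forall w, f w != 0 -> word_deg w = d) ->
  (forall w, g w != 0 -> word_deg w = d') ->
  forall w, (f * g) w != 0 -> word_deg w = d + d'.
Proof.
move=> Hf Hg w; apply: contraNeq => ne; rewrite -fa_mulE /fa_mul big1 // => i _.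
have [->|fi] := eqVneq (f (take i w)) 0; first by rewrite mul0r.
have [->|gi] := eqVneq (g (drop i w)) 0; first by rewrite mulr0.
by case/eqP: ne; rewrite -(cat_take_drop i w) word_degD (Hf _ fi) (Hg _ gi).
Qed.

Lemma homog_mono w u : mono K w u != 0 -> word_deg u = word_deg w.
Proof. by rewrite mono_eq; case: (eqVneq u w) => [->|_] //; rewrite eqxx. Qed.

Lemma homogB d f g : (forall w, f w != 0 -> word_deg w = d) ->
  (forall w, g w != 0 -> word_deg w = d) ->
  forall w, (f - g) w != 0 -> word_deg w = d.
Proof.
move=> Hf Hg w; have [fw|/Hf -> //] := eqVneq (f w) 0.
by rewrite fa_addE fa_oppE fw add0r oppr_eq0 => /Hg.
Qed.

Lemma homog_sum d (I : Type) (r : seq I) (F : I -> FA) :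
  (forall i w, F i w != 0 -> word_deg w = d) ->
  forall w, (\sum_(i <- r) F i) w != 0 -> word_deg w = d.
Proof.
move=> HF; elim/big_rec: _ => [|i f _ Hf] w; first by rewrite fa_0E eqxx.
have [fw|/HF -> //] := eqVneq (F i w) 0.
by rewrite fa_addE fw add0r => /Hf.
Qed.

Lemma lpa_rel_homog g : lpa_rel g -> exists d, forall w, g w != 0 -> word_deg w = d.
Proof.
have H1 (a : gen E) w : mono K [:: a] w != 0 -> word_deg w = gen_deg a.
  by move/homog_mono ->; rewrite /word_deg big_seq1.
have H2 (a b : gen E) w : (mono K [:: a] * mono K [:: b]) w != 0 ->
    word_deg w = gen_deg a + gen_deg b by move: w; apply: homogM; exact: H1.
case=> [v|v w _|e|e|e|e|e|e f _|v l _ _ _].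
- by exists 0; apply: homogB; [exact: (H2 (GV v) (GV v)) | exact: (H1 (GV v))].
- by exists 0; exact: (H2 (GV v) (GV w)).
- by exists 1; apply: homogB; [exact: (H2 (GV _) (GE e)) | exact: (H1 (GE e))].
- by exists 1; apply: homogB; [exact: (H2 (GE e) (GV _)) | exact: (H1 (GE e))].
- by exists (-1); apply: homogB; [exact: (H2 (GV _) (GS e)) | exact: (H1 (GS e))].
- by exists (-1); apply: homogB; [exact: (H2 (GS e) (GV _)) | exact: (H1 (GS e))].
- by exists 0; apply: homogB; [exact: (H2 (GS e) (GE e)) | exact: (H1 (GV _))].
- by exists 0; exact: (H2 (GS e) (GE f)).
exists 0; apply: homogB; first exact: (H1 (GV v)).
by rewrite fa_sumE big_map; apply: homog_sum => e; exact: (H2 (GE e) (GS e)).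
Qed.

Section GradedIdeal.
Variable G : FA -> Prop.
Hypothesis G_poly : forall g, G g -> poly g.
Hypothesis G_homog : forall g, G g -> exists d, forall w, g w != 0 -> word_deg w = d.

(** By linearity the multipliers may be taken to be words; then a g b is homogeneous, and its
    component is itself or zero. *)
Lemma gen_ideal_component d x : gen_ideal G x -> gen_ideal G (component d x).
Proof.
elim=> [|a g b fa fb Gg|y z _ Hy _ Hz]; first by rewrite component0; exact: gen_ideal0.
  elim/fin_ind: a / fa => [|k w a fa IHa].
    by rewrite !mul0r component0; exact: gen_ideal0.
  rewrite !mulrDl componentD -!scalerAl componentZ.
  apply: gen_idealD => //; apply: gen_idealZ; elim/fin_ind: b / fb {IHa} => [|c u b fb IHb].
    by rewrite !mulr0 component0; exact: gen_ideal0.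
  rewrite !mulrDr componentD -!scalerAr componentZ.
  apply: gen_idealD => //; apply: gen_idealZ; have [d' Hg] := G_homog Gg.
  rewrite (@component_homog d (word_deg w + d' + word_deg u)); last first.
    by apply: homogM; [apply: homogM => //; exact: homog_mono | exact: homog_mono].
  case: eqP => _; last exact: gen_ideal0.
  by apply: gen_ideal_gen => //; exact: fin_mono.
by rewrite componentD; exact: gen_idealD.
Qed.

Lemma gen_ideal_graded (I : FA -> Prop) :
  (forall x, I x <-> gen_ideal G x) -> graded I.
Proof.
move=> IE x /IE Gx; have [fx _] := gen_ideal_poly G_poly Gx.
have /fin_suppP [s us Hs] := fx; pose D := undup (map (@word_deg E) s).
exists [seq (d, component d x) | d <- D]; split=> [p /In_mem /mapP[d _ ->] /=|].
  have Gd := gen_ideal_component d Gx; split; first exact/IE.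
  split; first exact: gen_ideal_poly Gd.
  by move=> w; rewrite /component; case: (eqVneq (word_deg w) d) => // _; rewrite eqxx.
rewrite /lpa_eq fa_subE fa_sumE -map_comp big_map.
suff -> : \sum_(d <- D) component d x = x by rewrite subrr; exact: relI0.
apply/funext => w.
have -> : (\sum_(d <- D) component d x) w = \sum_(d <- D) component d x w.
  by elim/big_rec2: _ => // d y1 y2 _ <-.
have [xw|/Hs ws] := eqVneq (x w) 0.
  by rewrite xw big1 // => d _; rewrite /component xw if_same.
rewrite (bigD1_seq (word_deg w)) ?undup_uniq ?mem_undup ?map_f //= {1}/component eqxx.
by rewrite big1 ?addr0 // => d ne; rewrite /component eq_sym (negPf ne).
Qed.

Variable J : fideal K E.
Hypothesis JE : forall x, J x <-> gen_ideal G x.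

(** The degree 0 component of the sum is k v, and a graded ideal contains it along with the sum.
    This supplies the hypothesis [P_graded] of the reduction. *)
Lemma graded_vertex k v (l : seq (K * seq (edge E))) : k != 0 ->
  (forall t, t \in l -> t.2 != [::]) ->
  k *: qP J v + \sum_(t <- l) t.1 *: (qP J v * real_word (qX J) t.2) = 0 -> qP J v = 0.
Proof.
move=> k0 l0.
pose x : FA := k *: gv K v + \sum_(t <- l) t.1 *: mono K (GV v :: map (@GE E) t.2).
have fs (t : K * seq (edge E)) : fin_supp (t.1 *: mono K (GV v :: map (@GE E) t.2)).
  by apply: finZ; exact: fin_mono.
have fv : fin_supp (k *: gv K v) by apply: finZ; exact: fin_mono.
have fx : fin_supp x by apply: finD => //; exact: fin_sum.
have <- : qpi J x = k *: qP J v + \sum_(t <- l) t.1 *: (qP J v * real_word (qX J) t.2).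
  rewrite /x qpiD //; last exact: fin_sum.
  rewrite qpiZ ?qpi_sum //; last exact: fin_mono.
  congr (_ + _); apply: eq_bigr => t _; rewrite qpiZ; last exact: fin_mono.
  by rewrite mono_cons qpiM ?qpi_real //; exact: fin_mono.
move/(qpi_eq0 J fx)/JE/(gen_ideal_component 0).
have -> : component 0 x = k *: gv K v.
  rewrite /x componentD componentZ component_sum component_mono /word_deg big_seq1 eqxx.
  rewrite big_seq big1 ?addr0 // => t /l0 t0; rewrite componentZ component_mono.
  rewrite -cat1s word_degD word_deg_real {1}/word_deg big_seq1 add0r.
  by case: (t.2) t0 => //= e p _; rewrite scaler0.
move/(@gen_idealZ _ _ _ k^-1); rewrite scalerA mulVf // scale1r => Gv.
by apply/(qpi_eq0 J); [exact: fin_mono | exact/JE].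
Qed.

End GradedIdeal.
End Grading.

(** * Ideals under Condition (K) *)

Section IdealsK.
Variables (K : fieldType) (E : graph).
Local Notation FA := (FA K E).
Implicit Types (e f : edge E) (v w : vert E) (x y : FA) (H S : vert E -> Prop).

Definition vgap w (l : seq (edge E)) : FA := gv K w - \sum_(e <- l) ge K e * gs K e.

Definition leaving H w (l : seq (edge E)) : Prop :=
  uniq l /\ forall e, e \in l <-> src e = w /\ ~ H (rng e).

Lemma leaving_uniq H w l l' : leaving H w l -> leaving H w l' -> perm_eq l l'.
Proof.
move=> [ul Hl] [ul' Hl']; apply: uniq_perm => // e.
by apply/idP/idP; [move/Hl/Hl' | move/Hl'/Hl].
Qed.

Lemma fin_XY e : fin_supp (ge K e * gs K e).
Proof. by apply: finM; exact: fin_mono. Qed.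

Lemma poly_vgap w l : poly (vgap w l).
Proof.
apply: polyB; first exact: poly_mono.
by apply: poly_sum => e; apply: polyMl; [exact: fin_mono | exact: poly_mono].
Qed.

Lemma qpi_vgap (J : fideal K E) w l :
  qpi J (vgap w l) = qP J w - \sum_(e <- l) qX J e * qY J e.
Proof.
rewrite qpiB ?qpi_sum; [|exact: fin_XY|exact: fin_mono|by apply: fin_sum; exact: fin_XY].
by congr (_ - _); apply: eq_bigr => e _; rewrite qpiM //; exact: fin_mono.
Qed.

Definition vertices_of (I : FA -> Prop) v : Prop := I (gv K v).
Definition gaps_of (I : FA -> Prop) w : Prop :=
  breaking (vertices_of I) w /\ exists2 l, leaving (vertices_of I) w l & I (vgap w l).

(** The relations are among the generators, so that the ideal generated in the free algebra is the
    full preimage of the ideal of L. *)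
Inductive adm_gen H S : FA -> Prop :=
  | adm_gen_rel x : lpa_rel x -> adm_gen H S x
  | adm_gen_vert v : H v -> adm_gen H S (gv K v)
  | adm_gen_gap w l : S w -> leaving H w l -> adm_gen H S (vgap w l).

Lemma adm_gen_poly H S x : adm_gen H S x -> poly x.
Proof. by case=> [y|v _|w l _ _]; [exact: poly_rel | exact: poly_mono | exact: poly_vgap]. Qed.

Lemma adm_gen_homog H S x : adm_gen H S x -> exists d, forall w : word E, x w != 0 -> word_deg w = d.
Proof.
case=> [y|v _|w l _ _]; first exact: lpa_rel_homog.
  by exists 0 => u /homog_mono ->; rewrite /word_deg big_seq1.
exists 0; apply: homogB => [u /homog_mono ->|]; first by rewrite /word_deg big_seq1.
apply: homog_sum => e; rewrite -(subrr (1 : int)).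
by apply: homogM => u /homog_mono ->; rewrite /word_deg big_seq1.
Qed.

Definition adm_fideal H S : fideal K E :=
  FIdeal (gen_ideal_poly (@adm_gen_poly H S))
    (fun x rx => gen_idealS (@adm_gen_rel H S) (proj1 (relIE x) rx))
    (@gen_idealD _ _ _) (@gen_idealZ _ _ _) (@gen_idealM _ _ _).

Section OneIdeal.
Variable I : FA -> Prop.
Hypothesis idI : is_ideal I.
Local Notation H := (vertices_of I).
Local Notation S := (gaps_of I).
Local Notation QI := (ideal_fideal idI).

Lemma qP_eq0 v : qP QI v = 0 <-> H v.
Proof. by apply: (qpi_eq0 QI); exact: fin_mono. Qed.

Lemma vertices_rng e : H (src e) -> H (rng e).
Proof.
have lf := quot_family QI; move/qP_eq0 => se; apply/qP_eq0.
by rewrite -(lf_ee lf) -(lf_se lf) se mul0r mulr0.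
Qed.

Lemma ideal_admissible : admissible H S.
Proof.
have lf := quot_family QI; split; last split=> [v [l [l0 Hl]] Hr|w []//].
  move=> u v Hu /path_walk [p]; elim: p u Hu => [|e p IH] u Hu /= => [<- //|[eu]].
  by apply: IH; apply: vertices_rng; rewrite eu.
apply/qP_eq0; rewrite (@lf_ck _ _ _ _ _ _ lf v (undup l)) ?undup_uniq //.
- rewrite big_seq big1 // => e; rewrite mem_undup => /In_mem/Hl/Hr/qP_eq0 re.
  by rewrite -(lf_er lf) re mulr0 mul0r.
- case: l l0 {Hl} => // e l _ /(congr1 (fun s => e \in s)).
  by rewrite mem_undup mem_head.
- by move=> e; rewrite Hl mem_undup In_mem.
Qed.

Lemma adm_gen_ideal x : gen_ideal (adm_gen H S) x -> I x.
Proof.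
apply: gen_ideal_sub => // g [y ry|//|w l [_ [l' ll' Il']] ll].
  by apply: lpa_ideal_rel => //; apply/relIE; exact: gen_ideal_incl.
by rewrite /vgap (perm_big _ (leaving_uniq ll ll')).
Qed.

Hypothesis CK : condition_K E.

(** [lpa_sum_eq0] is applied in the quotient by [adm_fideal H S]. There a vertex in the image of [I]
    is already zero, and a gap element in the image of [I] is zero because its vertex is, or because
    it is one of the generators. *)
Lemma ideal_adm_gen x : I x <-> gen_ideal (adm_gen H S) x.
Proof.
split; last exact: adm_gen_ideal.
move=> Ix; pose J := adm_fideal H S.
have lf := quot_family J; have px := lpa_ideal_poly idI Ix; have [fx _] := px.
have JI y : J y -> I y by exact: adm_gen_ideal.
(* As J lies in [I], membership in [I] does not depend on the representative modulo J. *)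
have Iqpi y : fin_supp y -> I (qval (qpi J y)) <-> I y.
  move=> fy; have Iy := JI _ (qval_qpi J fy).
  split=> Iv; last by rewrite -(subrK y (qval _)); exact: lpa_idealD.
  by rewrite -(subKr (qval (qpi J y)) y); apply: lpa_idealD => //; exact: lpa_idealN.
have PJ v : qP J v = 0 <-> H v.
  have fv : fin_supp (gv K v) by exact: fin_mono.
  split=> [/(qpi_eq0 J fv)/JI //|Hv]; apply/(qpi_eq0 J fv).
  exact/gen_ideal_incl/adm_gen_vert.
apply/(qpi_eq0 J fx); have [l El] := spanned_poly J px; rewrite El.
apply: (@lpa_sum_eq0 _ _ _ _ _ _ lf (fun z => I (qval z))) => //.
- move=> a b z; elim/quot_ind: a => a fa; elim/quot_ind: b => b fb.
  elim/quot_ind: z => z fz /(Iqpi z fz) Iz.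
  have faz := finM fa fz; rewrite -(qpiM J fa fz) -(qpiM J faz fb); apply: (proj2 (Iqpi _ (finM faz fb))).
  exact: lpa_idealM.
- move=> k z; elim/quot_ind: z => z fz /(Iqpi z fz) Iz; rewrite -qpiZ //.
  by apply: (proj2 (Iqpi _ (finZ k fz))); exact: lpa_idealZ.
- by move=> v Iv; apply/PJ; apply/(Iqpi (gv K v)) => //; exact: fin_mono.
- move=> w l' nrw ul' Hl'; have fg : fin_supp (vgap w l') by case: (poly_vgap w l').
  rewrite -qpi_vgap => /(Iqpi _ fg) Ig; apply/(qpi_eq0 J fg).
  have ll' : leaving H w l' by split=> // e; rewrite Hl' PJ.
  have [Hw|nHw] := EM (H w).
    apply/(qpi_eq0 J fg); rewrite qpi_vgap (PJ w).2 // big_seq big1 ?subrr // => e /Hl'[ew].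
    by move=> _; rewrite -(lf_se lf) ew (PJ w).2 // mul0r mul0r.
  (* With no edge leaving H the gap element would be w itself, putting w into H. *)
  have [l'0|/eqP l'0] := eqVneq l' [::].
    by case: nHw; move: Ig; rewrite l'0 /vgap big_nil subr0.
  apply: gen_ideal_incl; apply: adm_gen_gap => //; split; last by exists l'.
  split; last split=> //; last first.
    by exists l'; split=> // e; rewrite In_mem; case: ll' => _ ->.
  (* Since w emits an edge, a finite list of its edges would make it regular; so w is an infinite
     emitter. *)
  move=> [L HL]; apply: nrw; exists L; split=> // L0.
  case: l' l'0 {ul' Ig fg ll'} Hl' => // e l' _ Hl'.
  by have [/HL] := (Hl' e).1 (mem_head _ _); rewrite L0.
- by move=> k u l' k0 l'0; exact: (graded_vertex (@adm_gen_homog H S)).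
by rewrite -El; apply/(Iqpi x fx).
Qed.

(** For a gap element of [I] at w: if w lies in B, so does the element. Otherwise B contains its own
    gap element at w, and the two differ only in terms e e^* with r(e) in B. *)
Lemma ideal_sub_of_le (B : FA -> Prop) : is_ideal B ->
  adm_le H S (vertices_of B) (gaps_of B) -> sub_ideal I B.
Proof.
move=> idB [HH SS] x /ideal_adm_gen; apply: gen_ideal_sub => // g [y ry|v /HH //|w l Sw [ul Hl]].
  by apply: lpa_ideal_rel => //; apply/relIE; exact: gen_ideal_incl.
pose J := ideal_fideal idB; have lf := quot_family J.
have fg : fin_supp (vgap w l) by case: (poly_vgap w l).
have PB v : qP J v = 0 <-> B (gv K v) by apply: (qpi_eq0 J); exact: fin_mono.
apply/(qpi_eq0 J fg); rewrite qpi_vgap; have [Bw|[_ [l' [ul' Hl'] Bg]]] := SS w Sw.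
  rewrite (PB w).2 // big_seq big1 ?subrr // => e /Hl[ew _].
  by rewrite -(lf_se lf) ew (PB w).2 // !mul0r.
have fg' : fin_supp (vgap w l') by case: (poly_vgap w l').
have /(qpi_eq0 J fg') := Bg; rewrite qpi_vgap => g0; rewrite -[RHS]g0; congr (_ - _).
have pl : perm_eq [seq e <- l | qP J (rng e) != 0] l'.
  apply: uniq_perm; rewrite ?filter_uniq // => e; rewrite mem_filter.
  apply/andP/idP => [[/eqP re /Hl[ew _]]|/Hl'[ew re]].
    by apply/Hl'; split=> // /PB.
  split; first by apply/eqP => /PB.
  by apply/Hl; split=> // /HH.
rewrite -(perm_big _ pl) big_filter [RHS]big_mkcond; apply: eq_bigr => e _.
by case: eqP => // re; rewrite -(lf_er lf) re mulr0 mul0r.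
Qed.

Lemma ideal_graded : graded I.
Proof. exact: (gen_ideal_graded (@adm_gen_poly H S) (@adm_gen_homog H S) ideal_adm_gen). Qed.

(** Each generator g is zero or idempotent modulo the relations, so a g b is congruent to the
    product of a g and g b. *)
Lemma sub_ideal_prod (A B : FA -> Prop) :
  sub_ideal I A -> sub_ideal I B -> sub_ideal I (ideal_prod A B).
Proof.
move=> IA IB x Ix; split; first exact: lpa_ideal_poly Ix.
have /ideal_adm_gen := Ix; elim=> [|a g b fa fb Gg|y z _ [l [Hl yl]] _ [l' [Hl' zl']]].
- by exists [::]; split=> //; rewrite /lpa_eq fa_subE subr0; exact: relI0.
- have Ig : I g by apply: adm_gen_ideal; exact: gen_ideal_incl.
  have pg := lpa_ideal_poly idI Ig.
  have fab : fin_supp (a * g) by apply: finM => //; case: pg.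
  have [rg|Rg] : relI g \/ relI (g - g * g).
    have [fg _] := pg; pose J := rel_fideal K E; have lf := quot_family J.
    case: Gg fg => [y ry|v _|w l Sw [ul Hl]] fg; [left|right|right].
    + by apply/relIE; exact: gen_ideal_incl.
    + apply/relIE; apply/(qpi_eq0 J); first by apply: finB => //; exact: finM.
      rewrite qpiB ?qpiM //; last exact: finM.
      by rewrite -/(qP J v) (lf_vv lf) subrr.
    apply/relIE; apply/(qpi_eq0 J); first by apply: finB => //; exact: finM.
    rewrite qpiB ?qpiM //; last exact: finM.
    by rewrite qpi_vgap (gap_idem lf) ?subrr // => e /Hl[].
  + exists [::]; split=> //; rewrite /lpa_eq fa_subE subr0.
    by apply/relIE; apply: gen_idealM => //; apply/relIE.
  exists [:: (a * g, g * b)]; split=> [p [<-|//]|] /=.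
    split; [apply: IA | apply: IB]; first by rewrite -[_ * g]mulr1; apply: lpa_idealM => //; exact: fin_mono.
    by rewrite -[g]mul1r; apply: lpa_idealM => //; exact: fin_mono.
  rewrite /lpa_eq fa_subE.
  have -> : fa_add (fa_mul (a * g) (g * b)) (@fa0 K E) = a * g * (g * b) by exact: addr0.
  have -> : a * g * b - a * g * (g * b) = a * (g - g * g) * b.
    by rewrite mulrBr mulrBl !mulrA.
  by apply/relIE; apply: gen_idealM => //; apply/relIE.
exists (l ++ l'); split=> [p /List.in_app_iff[/Hl|/Hl']//|].
rewrite /lpa_eq !fa_subE !fa_sumE in yl zl' *; rewrite map_cat big_cat /= opprD addrACA.
by apply/relIE; apply: gen_idealD; apply/relIE.
Qed.

End OneIdeal.
End IdealsK.

(** * Representations on branching systems *)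

(* [start t = None] marks junk points; [head_edge t = None] marks an end point. *)
Record branching (E : graph) (T : Type) := Branching {
  start : T -> option (vert E);
  head_edge : T -> option (edge E);
  tail_pt : T -> T;
  cons_pt : edge E -> T -> T;
  head_start : forall t e, head_edge t = Some e -> start t = Some (src e);
  tail_start : forall t e, head_edge t = Some e -> start (tail_pt t) = Some (rng e);
  cons_tail : forall t e, head_edge t = Some e -> cons_pt e (tail_pt t) = t;
  head_cons : forall t e, start t = Some (rng e) -> head_edge (cons_pt e t) = Some e;
  tail_cons : forall t e, start t = Some (rng e) -> tail_pt (cons_pt e t) = t;
  head_regular : forall t u, start t = Some u -> regular u -> head_edge t <> None
}.

Lemma eq_big_support (R : nmodType) (I : eqType) (s s' : seq I) (F : I -> R) :
  uniq s -> uniq s' -> (forall i, F i != 0 -> i \in s) -> (forall i, F i != 0 -> i \in s') ->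
  \sum_(i <- s) F i = \sum_(i <- s') F i.
Proof.
move=> us us' Hs Hs'.
have red r : \sum_(i <- r) F i = \sum_(i <- [seq i <- r | F i != 0]) F i.
  rewrite big_filter [RHS]big_mkcond; apply: eq_bigr => i _.
  by case: (eqVneq (F i) 0).
rewrite red [RHS]red; apply: perm_big; apply: uniq_perm; rewrite ?filter_uniq // => i.
rewrite !mem_filter; case: (eqVneq (F i) 0) => //= Fi.
by rewrite Hs // Hs'.
Qed.

Section Action.
Variables (K : fieldType) (E : graph) (T : Type) (B : branching E T) (V : lmodType K).
Variables tw twi : edge E -> V -> V.
Hypothesis tw_linear : forall e k (x y : V), tw e (k *: x + y) = k *: tw e x + tw e y.
Hypothesis twi_linear : forall e k (x y : V), twi e (k *: x + y) = k *: twi e x + twi e y.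
Hypothesis twK : forall e, cancel (tw e) (twi e).
Hypothesis twiK : forall e, cancel (twi e) (tw e).
Local Notation FA := (FA K E).
Local Notation word := (word E).
Implicit Types (f g : FA) (w : word) (F G : T -> V) (t : T).

(** The functions on points may have infinite support, and an operator is tested at a single point.
    An edge pulls back along the removal of the head and applies the automorphism [tw e]; its ghost
    undoes both. *)
Definition act_gen (a : gen E) F : T -> V := fun t =>
  match a with
  | GV v => if start B t == Some v then F t else 0
  | GE e => if head_edge B t == Some e then tw e (F (tail_pt B t)) else 0
  | GS e => if start B t == Some (rng e) then twi e (F (cons_pt B e t)) else 0
  end.

Definition act_word w F : T -> V := foldr act_gen F w.

Lemma act_gen_linear a k F G :
  act_gen a (fun t => k *: F t + G t) = fun t => k *: act_gen a F t + act_gen a G t.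
Proof.
apply/funext => t; case: a => [v|e|e] /=; case: eqP => _;
  by rewrite ?tw_linear ?twi_linear ?scaler0 ?addr0.
Qed.

Lemma act_word_linear w k F G :
  act_word w (fun t => k *: F t + G t) = fun t => k *: act_word w F t + act_word w G t.
Proof. by elim: w => //= a w IH; rewrite IH act_gen_linear. Qed.

Lemma act_word0 w : act_word w (fun=> 0) = fun=> 0.
Proof.
have := act_word_linear w (-1) (fun=> 0) (fun=> 0); rewrite scaler0 addr0 => ->.
by apply/funext => t; rewrite scaleN1r addNr.
Qed.

(** Some list of words covering the support; by [actE] the action does not depend on the choice. *)
Definition support f : seq word :=
  epsilon (inhabits [::]) (fun s => uniq s /\ forall w, f w != 0 -> w \in s).

Lemma supportP f : fin_supp f -> uniq (support f) /\ forall w, f w != 0 -> w \in support f.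
Proof.
move=> /fin_suppP [s us Hs].
by apply: (epsilon_spec (inhabits [::]) (fun s => uniq s /\ forall w, f w != 0 -> w \in s)); exists s.
Qed.

Definition act f F : T -> V := fun t => \sum_(w <- support f) f w *: act_word w F t.

Lemma actE f s F t : uniq s -> (forall w, f w != 0 -> w \in s) ->
  act f F t = \sum_(w <- s) f w *: act_word w F t.
Proof.
move=> us Hs; have /supportP [uf Hf] : fin_supp f by apply/fin_suppP; exists s.
have nz w : f w *: act_word w F t != 0 -> f w != 0.
  by apply: contraNneq => ->; rewrite scale0r.
by apply: eq_big_support => // w /nz; [exact: Hf | exact: Hs].
Qed.

Lemma act_mono w F : act (mono K w) F = act_word w F.
Proof.
apply/funext => t; rewrite (@actE _ [:: w]) // => [|u].
  by rewrite big_seq1 mono_eq eqxx scale1r.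
by rewrite mono_eq inE; case: (u == w); rewrite ?eqxx.
Qed.

Lemma act0 F : act 0 F = fun=> 0.
Proof. by apply/funext => t; rewrite (@actE _ [::]) ?big_nil // => w; rewrite fa_0E eqxx. Qed.

Lemma actZ k f F : fin_supp f -> act (k *: f) F = fun t => k *: act f F t.
Proof.
move=> /fin_suppP [s us Hs]; apply/funext => t; rewrite !(@actE _ s) // => [|w].
  by rewrite scaler_sumr; apply: eq_bigr => w _; rewrite scalerA.
by rewrite fa_scaleE => kf; apply: Hs; apply: contraNneq kf => ->; rewrite mulr0.
Qed.

Lemma actD f g F : fin_supp f -> fin_supp g ->
  act (f + g) F = fun t => act f F t + act g F t.
Proof.
move=> /fin_suppP [s us Hs] /fin_suppP [s' us' Hs']; apply/funext => t.
pose r := undup (s ++ s'); have ur : uniq r by exact: undup_uniq.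
have Hf w : f w != 0 -> w \in r by move/Hs => ws; rewrite mem_undup mem_cat ws.
have Hg w : g w != 0 -> w \in r by move/Hs' => ws; rewrite mem_undup mem_cat ws orbT.
rewrite !(@actE _ r) // => [|w].
  by rewrite -big_split; apply: eq_bigr => w _; rewrite scalerDl.
by have [fw|/Hf //] := eqVneq (f w) 0; rewrite fa_addE fw add0r => /Hg.
Qed.

Lemma actB f g F : fin_supp f -> fin_supp g ->
  act (f - g) F = fun t => act f F t - act g F t.
Proof.
move=> ff fg; rewrite actD //; last exact: finN.
by rewrite -scaleN1r actZ //; apply/funext => t; rewrite scaleN1r.
Qed.

Lemma act_sum (I : Type) (r : seq I) (f : I -> FA) F t : (forall i, fin_supp (f i)) ->
  act (\sum_(i <- r) f i) F t = \sum_(i <- r) act (f i) F t.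
Proof.
move=> fs; elim: r => [|i r IH]; first by rewrite !big_nil act0.
by rewrite !big_cons actD //= ?IH //; exact: fin_sum.
Qed.

Lemma actM f g F : fin_supp f -> fin_supp g -> act (f * g) F = act f (act g F).
Proof.
move=> ff fg; have mulw w : act (mono K w * g) F = act_word w (act g F).
  elim/fin_ind: g / fg => [|k u g fg IH]; first by rewrite mulr0 !act0 act_word0.
  have fu := fin_mono K u; have fwu := fin_mono K (w ++ u).
  rewrite mulrDr -scalerAr -monoM (actD F (finZ k fwu) (finM (fin_mono K w) fg)) IH.
  rewrite (actD F (finZ k fu) fg) (actZ k F fu) (actZ k F fwu) !act_mono act_word_linear.
  by rewrite /act_word foldr_cat.
elim/fin_ind: f / ff => [|k w f ff IH]; first by rewrite mul0r !act0.
have fw := fin_mono K w; rewrite mulrDl -scalerAl !actD ?actZ ?mulw ?act_mono ?IH //.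
- exact: finM.
- exact: finZ.
- by apply: finZ; exact: finM.
- exact: finM.
Qed.

Lemma act_zero f : act f (fun=> 0) = fun=> 0.
Proof.
by apply/funext => t; rewrite /act big1 // => w _; rewrite act_word0 scaler0.
Qed.

Lemma act_XY e F t : act (ge K e * gs K e) F t = if head_edge B t == Some e then F t else 0.
Proof.
rewrite actM ?act_mono /=; try exact: fin_mono.
by case: eqP => // te; rewrite (tail_start te) eqxx cons_tail // twiK.
Qed.

Lemma act_rel r F : lpa_rel r -> act r F = fun=> 0.
Proof.
have fm (a : gen E) : fin_supp (mono K [:: a]) by exact: fin_mono.
have f2 (a b : gen E) : fin_supp (fa_mul (mono K [:: a]) (mono K [:: b])) by exact: finM.
have tw0 e : tw e 0 = 0 by have := tw_linear e (-1) 0 0; rewrite scaler0 addr0 scaleN1r addNr.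
have twi0 e : twi e 0 = 0 by have := twi_linear e (-1) 0 0; rewrite scaler0 addr0 scaleN1r addNr.
have two (a b : gen E) t : act (mono K [:: a] * mono K [:: b]) F t = act_gen a (act_gen b F) t.
  by rewrite actM // !act_mono.
have sub0 (x y : FA) t : fin_supp x -> fin_supp y -> act x F t = act y F t -> act (fa_sub x y) F t = 0.
  by move=> fx fy xy; rewrite fa_subE actB // xy subrr.
move=> rr; apply/funext => t; case: rr => [v|v w vw|e|e|e|e|e|e f ef|v l l0 ul Hl];
  rewrite ?/gv ?/ge ?/gs.
- by apply: sub0 => //; rewrite fa_mulE two act_mono /=; case: eqP.
- rewrite fa_mulE two /=; case: eqP => // ->.
  by case: eqP => // -[] /vw.
- apply: sub0 => //; rewrite fa_mulE two act_mono /=.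
  case: (eqVneq (head_edge B t) (Some e)) => [te|_]; last by rewrite if_same.
  by rewrite (head_start te) eqxx.
- apply: sub0 => //; rewrite fa_mulE two act_mono /=.
  case: (eqVneq (head_edge B t) (Some e)) => [te|//].
  by rewrite (tail_start te) eqxx.
- apply: sub0 => //; rewrite fa_mulE two act_mono /=.
  by case: eqP.
- apply: sub0 => //; rewrite fa_mulE two act_mono /=.
  by case: eqP => // te; rewrite (head_start (head_cons te)) eqxx.
- apply: sub0 => //; rewrite fa_mulE two act_mono /=.
  by case: eqP => // te; rewrite head_cons // eqxx tail_cons // twK.
- rewrite fa_mulE two /=; case: eqP => // te; rewrite head_cons //.
  by case: eqP => [[] /ef|_].
apply: sub0 => //; first by rewrite fa_sumE big_map; apply: fin_sum => e; exact: f2.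
rewrite fa_sumE big_map act_sum; last by move=> e; exact: f2.
rewrite act_mono /= (eq_bigr (fun e => if head_edge B t == Some e then F t else 0)); last first.
  by move=> e _; exact: act_XY.
have {}ul : uniq l by apply/NoDup_uniq.
have {}Hl e : src e = v <-> e \in l by rewrite Hl In_mem.
case: eqP => [tv|ntv].
  have rv : regular v by exists l; split=> // e; rewrite Hl In_mem.
  (* A point that starts at a regular vertex has a head edge, so exactly one term of the sum
     contributes. *)
  have := head_regular tv rv; case te: (head_edge B t) => [e|//] _.
  have el : e \in l by apply/Hl; have := head_start te; rewrite tv => -[].
  rewrite (bigD1_seq e) //= eqxx big1 ?addr0 // => f; rewrite eq_sym => ne.
  by rewrite (inj_eq Some_inj) (negPf ne).
rewrite big_seq big1 // => e /Hl ev; case: eqP => // te.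
by case: ntv; rewrite (head_start te) ev.
Qed.

Lemma act_relI r F : relI r -> act r F = fun=> 0.
Proof.
move/relIE => H; elim: H F => [|a g b fa fb rg|x y rx IHx ry IHy] F; first exact: act0.
  have [fg _] := poly_rel rg.
  rewrite actM //; last exact: finM.
  by rewrite actM // (act_rel _ rg) act_zero.
have fin z : gen_ideal (@lpa_rel K E) z -> fin_supp z.
  by move/gen_ideal_poly => H; case: H => //; exact: poly_rel.
rewrite actD ?IHx ?IHy; [|exact: fin|exact: fin].
by apply/funext => t; rewrite addr0.
Qed.

Definition annihilator f : Prop := poly f /\ forall F t, act f F t = 0.

Lemma annihilator_ideal : is_ideal annihilator.
Proof.
split; first by move=> x [].
split=> [x y [px ax] py /act_relI xy|].
  split=> // F t; have [[fx _] [fy _]] := (px, py).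
  have := congr1 (fun h => h t) (xy F); rewrite fa_subE actB //= ax sub0r.
  by move/eqP; rewrite oppr_eq0 => /eqP.
split; first by split=> [|F t]; [exact: poly0 | rewrite (act0 F)].
split=> [x y [px ax] [py ay]|].
  split=> [|F t]; first exact: polyD.
  by have [[fx _] [fy _]] := (px, py); rewrite (actD F fx fy) ax ay addr0.
split=> [x [px ax]|x a [px ax] pa].
  split=> [|F t]; first exact: polyN.
  have [fx _] := px; have -> : fa_opp x = (-1) *: x by rewrite scaleN1r.
  by rewrite actZ // ax scaler0.
have [[fx _] [fa _]] := (px, pa); split; (split; [|move=> F t]).
- exact: polyMl.
- rewrite fa_mulE actM //.
  have -> : act x F = (fun=> 0) by apply/funext => s; exact: ax.
  by rewrite act_zero.
- exact: polyMr.
- by rewrite fa_mulE actM // ax.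
Qed.

(** Comparability will only speak of powers x^n. For test elements that act pointwise, powers become
    iterates. *)
Lemma act_exp f (m : T -> V -> V) : fin_supp f ->
  (forall F t, act f F t = m t (F t)) ->
  forall n F t, act (f ^+ n) F t = iter n (m t) (F t).
Proof.
move=> ff fm; have fX n : fin_supp (f ^+ n).
  by elim: n => [|n IH]; [exact: fin_mono | rewrite exprS; exact: finM].
elim=> [|n IH] F t; first by rewrite expr0 -mono1 act_mono.
by rewrite exprS actM // fm IH.
Qed.

Lemma act_gv v F t : act (gv K v) F t = if start B t == Some v then F t else 0.
Proof. by rewrite act_mono. Qed.

Lemma act_vgap (w : vert E) (l : seq (edge E)) F t : uniq l -> (forall e, e \in l -> src e = w) ->
  act (vgap K w l) F t = if (start B t == Some w) && ~~ has (fun e => head_edge B t == Some e) l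
    then F t else 0.
Proof.
move=> ul lw; rewrite actB; [|exact: fin_mono|by apply: fin_sum; exact: fin_XY].
rewrite act_gv act_sum; last exact: fin_XY.
rewrite (eq_bigr (fun e => if head_edge B t == Some e then F t else 0)); last first.
  by move=> e _; exact: act_XY.
have [/hasP[e el /eqP te]|/hasPn nl] := boolP (has _ l); last first.
  by rewrite big_seq big1 ?subr0 ?andbT // => e /nl /negPf ->.
rewrite andbF (head_start te) (lw e el) eqxx (bigD1_seq e) //= te eqxx big1 ?addr0 ?subrr //.
by move=> f ne; rewrite (inj_eq Some_inj) eq_sym (negPf ne).
Qed.

End Action.

(** * The path representation of an admissible pair *)

Section Streams.
Variables (E : graph) (H S : vert E -> Prop).
Hypothesis admHS : admissible H S.

(* A vertex together with a stream of edges; the first [None] ends the path, and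
   what follows it is junk. *)
Definition stream : Type := (vert E * (nat -> option (edge E)))%type.
Implicit Types (t : stream) (e : edge E) (u v w : vert E).

Definition shift t : stream :=
  (if t.2 0%N is Some e then rng e else t.1, fun n => t.2 n.+1).

(** Stopping is forbidden at regular vertices by the last relation of L, and at vertices of [S] so
    that their gap elements act as zero. *)
Definition step_ok t : Prop :=
  ~ H t.1 /\ (if t.2 0%N is Some e then src e = t.1 else ~ regular t.1 /\ ~ S t.1).

Definition stream_ok t : Prop := forall n, step_ok (iter n shift t).

Definition stream_cons e t : stream :=
  (src e, fun n => if n is m.+1 then t.2 m else Some e).

Definition stream_start t := if `[< stream_ok t >] then Some t.1 else None.
Definition stream_head t := if `[< stream_ok t >] then t.2 0%N else None.

Lemma stream_ok_shift t : stream_ok t -> stream_ok (shift t).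
Proof. by move=> ok n; rewrite -iterSr; exact: ok. Qed.

Lemma stream_startE t u : stream_start t = Some u <-> stream_ok t /\ t.1 = u.
Proof. by rewrite /stream_start; case: asboolP => ok; split=> //; [case | case=> _ -> | case]. Qed.

Lemma stream_headE t e : stream_head t = Some e <-> stream_ok t /\ t.2 0%N = Some e.
Proof. by rewrite /stream_head; case: asboolP => ok; split=> //; case. Qed.

Lemma shift_cons e t : t.1 = rng e -> shift (stream_cons e t) = t.
Proof. by case: t => u x /= ->. Qed.

Lemma stream_ok_cons e t : stream_ok t -> t.1 = rng e -> stream_ok (stream_cons e t).
Proof.
move=> ok te [|n]; last by rewrite iterSr shift_cons.
split=> // He; have [] := ok 0%N; rewrite te => + _; apply.
by have [her _] := admHS; apply: (her _ _ He); apply/path_walk; exists [:: e].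
Qed.

Lemma stream_head_start t e : stream_head t = Some e -> stream_start t = Some (src e).
Proof.
move=> /stream_headE [ok te]; apply/stream_startE; split=> //.
by have [_] := ok 0%N; rewrite te.
Qed.

Lemma stream_tail_start t e : stream_head t = Some e -> stream_start (shift t) = Some (rng e).
Proof.
move=> /stream_headE [ok te]; apply/stream_startE; split; first exact: stream_ok_shift.
by rewrite /shift te.
Qed.

Lemma stream_cons_tail t e : stream_head t = Some e -> stream_cons e (shift t) = t.
Proof.
move=> he; have /stream_startE [_ te] := stream_head_start he.
case/stream_headE: he => _; case: t te => u x /= -> x0; congr pair.
by apply/funext => -[].
Qed.

Lemma stream_head_cons t e : stream_start t = Some (rng e) -> stream_head (stream_cons e t) = Some e.
Proof. by move=> /stream_startE [ok te]; apply/stream_headE; split=> //; exact: stream_ok_cons. Qed.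

Lemma stream_tail_cons t e : stream_start t = Some (rng e) -> shift (stream_cons e t) = t.
Proof. by move=> /stream_startE [_]; exact: shift_cons. Qed.

Lemma stream_regular t u : stream_start t = Some u -> regular u -> stream_head t <> None.
Proof.
move=> /stream_startE [ok <-] ru; rewrite /stream_head asboolT //.
by have [_] := ok 0%N => /=; case: (t.2 0%N) => // -[].
Qed.

Definition stream_branching : branching E stream :=
  Branching stream_head_start stream_tail_start stream_cons_tail
    stream_head_cons stream_tail_cons stream_regular.

(** Follow edges with range outside [H] as long as there is one. Where there is none, the vertex is
    not regular by saturation and not in [S] because a breaking vertex has such an edge; so the path
    may stop. *)
Lemma stream_exists u : ~ H u -> exists t, stream_start t = Some u.
Proof.
move=> Hu; pose Q w e := src e = w /\ ~ H (rng e).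
pose nx w : option (edge E) := if pselect (exists e, Q w e) is left h then Some (projT1 (cid h)) else None.
have nxP w e : nx w = Some e -> Q w e.
  by rewrite /nx; case: pselect => // h [<-]; case: (cid h).
have nxN w : nx w = None -> forall e, ~ Q w e.
  by rewrite /nx; case: pselect => // h _ e Qe; apply: h; exists e.
pose step w := if nx w is Some e then rng e else w.
pose path w : stream := (w, fun n => nx (iter n step w)).
have shift_path w : shift (path w) = path (step w).
  by congr pair; apply/funext => n; rewrite /= -iterSr.
exists (path u); apply/stream_startE; split=> // n.
have -> : iter n shift (path u) = path (iter n step u).
  by elim: n => //= n ->; rewrite shift_path.
have : ~ H (iter n step u).
  elim: n => //= n IH; rewrite {1}/step; case e: (nx _) => [f|//].
  by case: (nxP _ _ e).
move: (iter n step u) => w Hw; split=> //=.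
case e: (nx w) => [f|]; first by case: (nxP _ _ e).
have [_ [sat brk]] := admHS; split=> [rw|/brk[_ [_ [[|f l] [// _ Hl]]]]].
  by apply: Hw; apply: sat => // f fw; apply: contrapT => Hf; apply: (nxN _ e f).
by apply: (nxN _ e f); apply/Hl; left.
Qed.

Lemma stream_stop w : ~ H w -> ~ regular w -> ~ S w ->
  exists t, stream_start t = Some w /\ stream_head t = None.
Proof.
move=> Hw rw Sw; pose t : stream := (w, fun=> None).
have ok : stream_ok t by elim=> //= n IH; rewrite -iterS iterSr.
by exists t; split; [apply/stream_startE | rewrite /stream_head asboolT].
Qed.

Variable K : fieldType.
Definition stream_ann : FA K E -> Prop :=
  annihilator stream_branching (V := K^o) (fun=> id) (fun=> id).

Let idl (e : edge E) (k : K) (x y : K^o) : id (k *: x + y) = k *: id x + id y.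
Proof. by []. Qed.
Let idc (e : edge E) : cancel (@id K^o) id. Proof. by []. Qed.
Local Notation stream_act := (act stream_branching (V := K^o) (fun=> id) (fun=> id)).

Lemma stream_ann_ideal : is_ideal stream_ann.
Proof. exact: (annihilator_ideal _ idl idl idc idc). Qed.

Lemma stream_ann_gv v : H v -> stream_ann (gv K v).
Proof.
move=> Hv; split=> [|F t]; first exact: poly_mono.
rewrite act_gv; case: eqP => // /stream_startE [ok tv].
by have [] := ok 0%N; rewrite tv.
Qed.

(** A path at a vertex of [S] cannot stop there, and the range of its first edge is outside [H], so
    this edge is in [l]. *)
Lemma stream_ann_vgap w l : S w -> leaving H w l -> stream_ann (vgap K w l).
Proof.
move=> Sw [ul Hl]; split=> [|F t]; first exact: poly_vgap.
rewrite (act_vgap _ idl idl idc) // => [|e /Hl[]//]; case: eqP => //= /stream_startE [ok tw].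
have [_] := ok 0%N => /=; case te: (t.2 0%N) => [e|]; last by case=> _; rewrite tw.
move=> et; have /hasP -> // : exists2 e, e \in l & stream_head t == Some e.
exists e; last by apply/eqP/stream_headE.
apply/Hl; split; first by rewrite et.
by have [] := ok 1%N; rewrite /= te.
Qed.

Lemma stream_ann_gvX v n : (0 < n)%N -> stream_ann (gv K v ^+ n) -> H v.
Proof.
move=> n0 [_ ann]; apply: contrapT => /stream_exists [t tv].
pose m (s : stream) (x : K^o) : K^o := if stream_start s == Some v then x else 0.
have am F s : stream_act (gv K v) F s = m s (F s) by exact: act_gv.
have := ann (fun=> 1) t; rewrite (act_exp idl idl (fin_mono _ _) am).
rewrite -(prednK n0) /=; have -> k : iter k (m t) 1 = 1.
  by elim: k => //= k ->; rewrite /m tv eqxx.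
by rewrite /m tv eqxx => /eqP; rewrite oner_eq0.
Qed.

(** Otherwise the path that stops at once at w is a point without head edge, at which all powers of
    the gap element act as the identity. *)
Lemma stream_ann_vgapX w (l : seq (edge E)) n : uniq l -> (forall e, e \in l -> src e = w) ->
  (0 < n)%N -> ~ regular w -> stream_ann (vgap K w l ^+ n) -> H w \/ S w.
Proof.
move=> ul lw n0 rw [_ ann]; apply: contrapT => /not_orP [Hw Sw].
have [t [tw th]] := stream_stop Hw rw Sw.
pose m (s : stream) (x : K^o) : K^o :=
  if (stream_start s == Some w) && ~~ has (fun e => stream_head s == Some e) l then x else 0.
have mt x : m t x = x.
  rewrite /m tw eqxx; case: hasP => // -[e _]; by rewrite th.
have am F s : stream_act (vgap K w l) F s = m s (F s) by exact: (act_vgap _ idl idl idc).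
have fg : fin_supp (vgap K w l) by case: (poly_vgap K w l).
have := ann (fun=> 1) t; rewrite (act_exp idl idl fg am).
have -> : iter n (m t) 1 = 1 by elim: (n) => //= k ->.
by move/eqP; rewrite oner_eq0.
Qed.

End Streams.

(** * Comparability up to powers and the chain of admissible pairs *)

Section Comparable.
Variables (K : fieldType) (E : graph).

(** The exponent leaves room for (2), where A and B meet in a power of a prime ideal; for (3) it is
    1. *)
Definition power_comparable : Prop := forall A B : FA K E -> Prop,
  is_ideal A -> is_ideal B -> exists n, (0 < n)%N /\
    ((forall x, A x -> B (x ^+ n)) \/ (forall x, B x -> A (x ^+ n))).

Lemma leaving_exists (H : vert E -> Prop) w : breaking H w -> exists l, leaving H w l.
Proof.
move=> [_ [_ [l [_ Hl]]]]; exists (undup l); split; first exact: undup_uniq.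
by move=> e; rewrite mem_undup -In_mem -Hl.
Qed.

Lemma infinite_not_regular (w : vert E) : infinite_emitter w -> ~ regular w.
Proof. by move=> iw [l [_ Hl]]; apply: iw; exists l. Qed.

Lemma ann_le H1 S1 H2 S2 (adm1 : admissible H1 S1) (adm2 : admissible H2 S2) n :
  (0 < n)%N -> (forall x : FA K E, stream_ann adm1 x -> stream_ann adm2 (x ^+ n)) ->
  adm_le H1 S1 H2 S2.
Proof.
move=> n0 A12; split=> [v Hv|w Sw].
  by have /A12/(stream_ann_gvX n0) := @stream_ann_gv _ _ _ adm1 K _ Hv.
have [_ [_ brk]] := adm1; have bw := brk w Sw; have [l lw] := leaving_exists bw.
have nrw : ~ regular w by case: bw => /infinite_not_regular.
have [ul Hl] := lw; have /A12 := @stream_ann_vgap _ _ _ adm1 K _ _ Sw lw.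
by apply: stream_ann_vgapX => // e /Hl[].
Qed.

Lemma comparable_chain : power_comparable -> admissible_chain E.
Proof.
move=> C H1 S1 H2 S2 adm1 adm2.
have [n [n0 [A12|A21]]] := C _ _ (@stream_ann_ideal _ _ _ adm1 K) (@stream_ann_ideal _ _ _ adm2 K).
  by left; exact: ann_le A12.
by right; exact: ann_le A21.
Qed.

End Comparable.

(** * Necessity of Condition (K) *)

Lemma mem_split (T : eqType) (x : T) (s : seq T) : x \in s -> exists a b, s = a ++ x :: b.
Proof. by case/splitPr => a b; exists a, b. Qed.

Section Cycle.
Variables (E : graph) (v : vert E) (c1 : edge E) (c2 : seq (edge E)).
Let c := c1 :: c2.
Hypothesis cv : walk v c v.
Hypothesis c_min : forall p, p <> [::] -> walk v p v -> (size c <= size p)%N.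
Hypothesis c_edges : forall p e, p <> [::] -> walk v p v -> e \in p -> e \in c.
Implicit Types (p q : seq (edge E)) (e f : edge E) (u w : vert E).

(** If two edges of c shared a source, omitting the stretch from one to the other would leave a
    shorter closed walk at v, against [c_min]. *)
Lemma cycle_src_uniq p q r e f : c = p ++ e :: q ++ f :: r -> src e <> src f.
Proof.
move=> ce ef; have := cv; rewrite ce => /walk_cat [u pu [eu /walk_cat [w _ [fw fv]]]].
have H : walk v (p ++ f :: r) v by apply/walk_cat; exists u => //=; rewrite -ef.
have r0 : p ++ f :: r <> [::] by case: (p).
by have := c_min r0 H; rewrite ce !size_cat /= size_cat leq_add2l ltnNge leq_addl.
Qed.

Lemma cycle_src_inj e f : e \in c -> f \in c -> src e = src f -> e = f.
Proof.
move=> ec fc ef; have [p [q cE]] := mem_split ec.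
move: (fc); rewrite cE mem_cat inE => /or3P[/mem_split[p1 [p2 pE]]|/eqP //|/mem_split[q1 [q2 qE]]].
  by case: (@cycle_src_uniq p1 p2 q f e) => //; rewrite cE pE -catA.
by case: (@cycle_src_uniq p q1 q2 e f) => //; rewrite cE qE.
Qed.

(** Both edges lie on closed walks at v, hence on c by [c_edges], where the source determines the
    edge. *)
Lemma cycle_only_exit u p q r e f : walk v p u -> src e = u -> src f = u ->
  walk (rng e) q v -> walk (rng f) r v -> e = f.
Proof.
move=> pu eu fu qv rv; apply: cycle_src_inj; last by rewrite eu.
  apply: (c_edges (p := p ++ e :: q)); first by case: (p).
    by apply/walk_cat; exists u.
  by rewrite mem_cat mem_head orbT.
apply: (c_edges (p := p ++ f :: r)); first by case: (p).
  by apply/walk_cat; exists u.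
by rewrite mem_cat mem_head orbT.
Qed.

(* Walks that stop at their first visit to [v]; they stand for the infinite paths
   that end by running around the cycle [c] forever. *)
Fixpoint first_walk u p : Prop :=
  match p with [::] => u = v | e :: q => [/\ u <> v, src e = u & first_walk (rng e) q] end.

Lemma first_walkW u p : first_walk u p -> walk u p v.
Proof. by elim: p u => [|e p IH] u //= [_ eu /IH]. Qed.

(** At a vertex reached from v, as [a] witnesses for [u], only one edge leads back to v. *)
Lemma first_walk_uniq u p q a : walk v a u -> first_walk u p -> first_walk u q -> p = q.
Proof.
elim: p u q a => [|e p IH] u [|f q] a /= au; [by []|by move=> -> []|by case=> ne _ _ /ne|].
move=> [_ eu ep] [_ fu fq].
have ef := cycle_only_exit au eu fu (first_walkW ep) (first_walkW fq).
congr cons => //; apply: (IH (rng e) q (a ++ [:: e])) => //; last by rewrite ef.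
by apply/walk_cat; exists u.
Qed.

Lemma first_walk_c2 : first_walk (rng c1) c2.
Proof.
have [c1v] := cv; have : forall p f q, c2 = p ++ f :: q -> src f <> v.
  move=> p f q c2E fv; apply: (@cycle_src_uniq [::] p q c1 f); last by rewrite fv.
  by rewrite /c c2E.
elim: (c2) (rng c1) => [|e p IH] u //= np [eu rv]; split=> //.
  by rewrite -eu; exact: (np [::] e p).
by apply: IH => // p' f q pE; apply: (np (e :: p') f q); rewrite pE.
Qed.

Definition fwalk : Type := (vert E * seq (edge E))%type.
Implicit Types t : fwalk.

Definition fwalk_start t := if `[< first_walk t.1 t.2 >] then Some t.1 else None.
(** The trivial walk at v stands for c c c ..., so its head is [c1], the default of [head], and its
    tail is the first return [c2] from [rng c1]. *)
Definition fwalk_head t :=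
  if `[< first_walk t.1 t.2 >] then Some (head c1 t.2) else None.
Definition fwalk_tail t : fwalk := if t.2 is e :: p then (rng e, p) else (rng c1, c2).
Definition fwalk_cons e t : fwalk := if src e == v then (v, [::]) else (src e, e :: t.2).

Lemma fwalk_startE t u : fwalk_start t = Some u <-> first_walk t.1 t.2 /\ t.1 = u.
Proof. by rewrite /fwalk_start; case: asboolP => ok; split=> //; [case | case=> _ -> | case]. Qed.

Lemma fwalk_headE t e : fwalk_head t = Some e <-> first_walk t.1 t.2 /\ head c1 t.2 = e.
Proof. by rewrite /fwalk_head; case: asboolP => ok; split=> //; [case | case=> _ -> | case]. Qed.

Lemma src_c1 : src c1 = v. Proof. by case: cv. Qed.

Lemma fwalk_head_start t e : fwalk_head t = Some e -> fwalk_start t = Some (src e).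
Proof.
move=> /fwalk_headE [ok <-]; apply/fwalk_startE; split=> //.
by case: t ok => u [|f p] /=; [rewrite src_c1 | case].
Qed.

Lemma fwalk_tail_start t e : fwalk_head t = Some e -> fwalk_start (fwalk_tail t) = Some (rng e).
Proof.
move=> /fwalk_headE [ok <-]; apply/fwalk_startE.
by case: t ok => u [|f p] /= ok; split=> //; [exact: first_walk_c2 | case: ok].
Qed.

Lemma fwalk_cons_tail t e : fwalk_head t = Some e -> fwalk_cons e (fwalk_tail t) = t.
Proof.
move=> /fwalk_headE [ok <-]; rewrite /fwalk_cons.
case: t ok => u [|f p] /=; first by move=> ->; rewrite src_c1 eqxx.
by move=> [/eqP/negPf uv -> _]; rewrite uv.
Qed.

(** Since [rng e] leads back to v, the edge is [c1] and the walk is the unique first return. Hence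
    nothing is lost when [fwalk_cons] collapses c1 c2 to the trivial walk. *)
Lemma fwalk_cons_v t e : fwalk_start t = Some (rng e) -> src e = v -> e = c1 /\ t = (rng c1, c2).
Proof.
case: t => u p /fwalk_startE [/= ok ue] ev.
have ec : e = c1.
  apply: (@cycle_only_exit v [::] p c2 e c1) => //; first exact: src_c1.
    by rewrite -ue; exact: first_walkW.
  exact: first_walkW first_walk_c2.
split=> //; rewrite ue ec; congr pair.
apply: (@first_walk_uniq (rng c1) p c2 [:: c1]); last exact: first_walk_c2.
  by split=> //; exact: src_c1.
by rewrite -ec -ue.
Qed.

Lemma fwalk_head_cons t e : fwalk_start t = Some (rng e) -> fwalk_head (fwalk_cons e t) = Some e.
Proof.
move=> te; apply/fwalk_headE; rewrite /fwalk_cons.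
case: eqP => [/(fwalk_cons_v te)[-> _] //|ne] /=.
by case/fwalk_startE: te => ok <-.
Qed.

Lemma fwalk_tail_cons t e : fwalk_start t = Some (rng e) -> fwalk_tail (fwalk_cons e t) = t.
Proof.
move=> te; rewrite /fwalk_cons; case: eqP => [/(fwalk_cons_v te)[_ ->] //|ne].
by case: t te => u p /fwalk_startE [_ /= ->].
Qed.

Lemma fwalk_regular t u : fwalk_start t = Some u -> regular u -> fwalk_head t <> None.
Proof. by move=> /fwalk_startE [ok _] _; rewrite /fwalk_head asboolT. Qed.

Definition fwalk_branching : branching E fwalk :=
  Branching fwalk_head_start fwalk_tail_start fwalk_cons_tail
    fwalk_head_cons fwalk_tail_cons fwalk_regular.

(** * Twisting the cycle by an automorphism *)

Section Twist.
Variables (K : fieldType) (V : lmodType K) (M Mi : V -> V).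
Hypothesis M_linear : forall k (x y : V), M (k *: x + y) = k *: M x + M y.
Hypothesis Mi_linear : forall k (x y : V), Mi (k *: x + y) = k *: Mi x + Mi y.
Hypothesis MK : cancel M Mi.
Hypothesis MiK : cancel Mi M.

Definition twist e : V -> V := if e == c1 then M else id.
Definition twisti e : V -> V := if e == c1 then Mi else id.

Lemma twist_linear e k x y : twist e (k *: x + y) = k *: twist e x + twist e y.
Proof. by rewrite /twist; case: ifP. Qed.
Lemma twisti_linear e k x y : twisti e (k *: x + y) = k *: twisti e x + twisti e y.
Proof. by rewrite /twisti; case: ifP. Qed.
Lemma twistK e : cancel (twist e) (twisti e).
Proof. by rewrite /twist /twisti; case: ifP => // _ x. Qed.
Lemma twistiK e : cancel (twisti e) (twist e).
Proof. by rewrite /twist /twisti; case: ifP => // _ x. Qed.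

Local Notation actw := (act fwalk_branching twist twisti).
Definition cycle_ann : FA K E -> Prop := annihilator fwalk_branching twist twisti.

Lemma cycle_ann_ideal : is_ideal cycle_ann.
Proof.
apply: annihilator_ideal;
  [exact: twist_linear | exact: twisti_linear | exact: twistK | exact: twistiK].
Qed.

Definition cycle_word : FA K E := mono K (map (@GE E) c).

(** One lap leads from [(v, [::])] back to itself and meets the twisted edge [c1] once, because the
    edges of a first walk do not start at v. *)
Lemma act_cycle F t :
  actw cycle_word F t = if fwalk_start t == Some v then M (F t) else 0.
Proof.
have along u p : first_walk u p ->
    act_word fwalk_branching twist twisti (map (@GE E) p) F (u, p) = F (v, [::]).
  elim: p u => [|e p IH] u /=; first by move=> ->.
  move=> [uv eu ok]; have -> : fwalk_head (u, e :: p) = Some e by apply/fwalk_headE.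
  rewrite eqxx /twist; case: eqP => [ec|_]; first by case: uv; rewrite -eu ec src_c1.
  exact: IH.
rewrite /cycle_word act_mono /=; case: eqP => [/fwalk_headE [ok tc]|nh].
  have tv : t = (v, [::]).
    case: t ok tc => u [|f p] /=; first by move=> ->.
    by move=> [uv fu _] fc; case: uv; rewrite -fu fc src_c1.
  rewrite tv (proj2 (fwalk_startE _ v)) // eqxx /twist eqxx /fwalk_tail /=.
  by rewrite along //; exact: first_walk_c2.
case: eqP => // /fwalk_startE [ok tv]; case: nh; apply/fwalk_headE; split=> //.
by case: t ok tv => u [|f p] //= [uv _ _].
Qed.

Definition one_minus_cycle : FA K E := gv K v - cycle_word.
(** The polynomial 1 - x + x^2 at the cycle. It equals 1 - x (1 - x), so it is comaximal with 1 - x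
    over every field. *)
Definition cycle_quadratic : FA K E := gv K v - cycle_word + cycle_word * cycle_word.

Lemma fin_cycle : fin_supp cycle_word. Proof. exact: fin_mono. Qed.

Lemma fin_one_minus_cycle : fin_supp one_minus_cycle.
Proof. by apply: finB; exact: fin_mono. Qed.

Lemma poly_one_minus_cycle : poly one_minus_cycle.
Proof. by apply: polyB; exact: poly_mono. Qed.

Lemma poly_cycle_quadratic : poly cycle_quadratic.
Proof.
apply: polyD; first exact: poly_one_minus_cycle.
by apply: polyMl; [exact: fin_mono | exact: poly_mono].
Qed.

Lemma act_one_minus_cycle F t :
  actw one_minus_cycle F t = if fwalk_start t == Some v then F t - M (F t) else 0.
Proof.
rewrite actB; [|exact: fin_mono|exact: fin_mono]; rewrite act_cycle act_gv /=.
by case: ifP => // _; rewrite subrr.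
Qed.

Lemma act_cycle_quadratic F t :
  actw cycle_quadratic F t = if fwalk_start t == Some v then F t - M (F t) + M (M (F t)) else 0.
Proof.
have fc := fin_cycle.
rewrite actD; [|exact: fin_one_minus_cycle|exact: finM].
rewrite actM //; [|exact: twist_linear|exact: twisti_linear].
rewrite act_one_minus_cycle !act_cycle.
by case: ifP => // _; rewrite addr0.
Qed.

End Twist.

Lemma cycle_not_comparable (K : fieldType) : ~ power_comparable K E.
Proof.
pose V := (K^o * K^o)%type : lmodType K.
(* The companion matrix of x^2 - x + 1; its determinant is 1, so it is invertible in every
   characteristic. *)
pose M (x : V) : V := (- x.2, x.1 + x.2).
pose Mi (x : V) : V := (x.1 + x.2, - x.1).
have M_linear k (x y : V) : M (k *: x + y) = k *: M x + M y.
  by congr pair; rewrite /= ?opprD ?scalerN // scalerDr addrACA.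
have Mi_linear k (x y : V) : Mi (k *: x + y) = k *: Mi x + Mi y.
  by congr pair; rewrite /= ?opprD ?scalerN // scalerDr addrACA.
have MK : cancel M Mi by move=> [a b]; congr pair; rewrite /= ?opprK // addrC addrK.
have MiK : cancel Mi M by move=> [a b]; congr pair; rewrite /= ?opprK // addrAC subrr add0r.
have idK : cancel (@id K^o) id by [].
have id_linear k (x y : K^o) : id (k *: x + y) = k *: id x + id y by [].
move=> /(_ _ _ (cycle_ann_ideal id_linear id_linear idK idK)
               (cycle_ann_ideal M_linear Mi_linear MK MiK)) [n [n0]].
have base : fwalk_start (v, [::]) == Some v by apply/eqP/fwalk_startE.
(* At v, the element v - c acts as zero for the identity twist and injectively for the companion
   matrix; v - c + c^2 acts as zero for the companion matrix and as the identity for the identity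
   twist. *)
case=> [/(_ (one_minus_cycle K))|/(_ (cycle_quadratic K))].
  case=> [|_ /(_ (fun=> ((1 : K), (0 : K))) (v, [::]))].
    split=> [|F t]; first exact: poly_one_minus_cycle.
    by rewrite act_one_minus_cycle // subrr if_same.
  pose m t (x : V) : V := if fwalk_start t == Some v then x - M x else 0.
  have am F t : act fwalk_branching (twist M) (twisti Mi) (one_minus_cycle K) F t = m t (F t).
    exact: act_one_minus_cycle.
  rewrite (act_exp (twist_linear M_linear) (twisti_linear Mi_linear) (fin_one_minus_cycle K) am).
  suff nz k : iter k (m (v, [::])) (1, 0) != 0 by move/eqP; rewrite (negPf (nz n)).
  elim: k => [|k IH]; first by rewrite /= xpair_eqE oner_eq0.
  apply: contraNneq IH; rewrite iterS /m base; move: (iter _ _ _) => [a b] /eqP.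
  rewrite subr_eq0 => /eqP [aE bE]; rewrite /= in bE.
  have a0 : a = 0 by apply: (addIr b); rewrite add0r -bE.
  have b0 : b = 0 by move/eqP: aE; rewrite a0 eq_sym oppr_eq0 => /eqP.
  by rewrite a0 b0.
case=> [|_ /(_ (fun=> (1 : K)) (v, [::]))].
  split=> [|F t]; first exact: poly_cycle_quadratic.
  rewrite act_cycle_quadratic //; case: ifP => // _; case: (F t) => a b.
  by congr pair; rewrite /= ?opprK; [rewrite subrr | rewrite addrACA subrr addNr addr0].
pose m t (x : K^o) : K^o := if fwalk_start t == Some v then x - x + x else 0.
have am F t : act fwalk_branching (twist (V := K^o) id) (twisti id) (cycle_quadratic K) F t = m t (F t).
  exact: (act_cycle_quadratic id_linear id_linear).
have fq : fin_supp (cycle_quadratic K) by case: (poly_cycle_quadratic K).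
rewrite (act_exp (twist_linear id_linear) (twisti_linear id_linear) fq am).
have -> : iter n (m (v, [::])) 1 = 1.
  by elim: (n) => //= k ->; rewrite /m base subrr add0r.
by move/eqP; rewrite oner_eq0.
Qed.

End Cycle.

(** * The implications between the four conditions *)

Section Equivalence.
Variables (K : fieldType) (E : graph).
Local Notation FA := (FA K E).

Lemma shortest_closed_walk (v : vert E) p : p <> [::] -> walk v p v ->
  exists c, [/\ c <> [::], walk v c v &
    forall q, q <> [::] -> walk v q v -> (size c <= size q)%N].
Proof.
have [n] := ubnP (size p); elim: n p => // n IH p pn p0 pv.
have [[q [q0 qv qp]]|np] := EM (exists q, [/\ q <> [::], walk v q v & (size q < size p)%N]).
  by apply: (IH q) => //; apply: leq_trans qp _.
exists p; split=> // q q0 qv; rewrite leqNgt; apply/negP => qp.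
by apply: np; exists q.
Qed.

(** If (K) fails for a closed path through v, all closed walks at v have the same edges, and a
    shortest one can serve as the cycle c. *)
Lemma comparable_condition_K : power_comparable K E -> condition_K E.
Proof.
move=> C mu v cmu vmu; apply: contrapT => nK.
have same p : p <> [::] -> walk v p v -> same_edge_set mu p.
  move=> p0 pv; have [cp bp] := closed_walk p0 pv.
  by apply: contrapT => nsame; apply: nK; exists p.
have [q [q0 qv _]] := closed_rot cmu vmu.
have [c [c0 cv cmin]] := shortest_closed_walk q0 qv.
case: c c0 cv cmin => // c1 c2 _ cv cmin.
apply: (@cycle_not_comparable _ v c1 c2 cv cmin _ K C) => p e p0 pv.
by rewrite -!In_mem => ep; apply/(same (c1 :: c2)) => //; apply/(same p p0 pv).
Qed.

Lemma comparable_condK_chain : power_comparable K E -> condK_admissible_chain E.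
Proof. by move=> C; split; [exact: comparable_condition_K C | exact: comparable_chain C]. Qed.

Lemma chain_comparable : all_graded_chain K E -> power_comparable K E.
Proof.
by move=> [_ ch] A B iA iB; exists 1%N; split=> //; case: (ch A B iA iB) => H;
  [left | right] => x; rewrite expr1; exact: H.
Qed.

Lemma ideal_prod_sub (A B C : FA -> Prop) : is_ideal C ->
  (forall x y, A x -> B y -> C (x * y)) -> sub_ideal (ideal_prod A B) C.
Proof.
move=> iC ABC x [px [l [Hl xl]]].
apply: (@lpa_ideal_eq _ _ _ iC (fa_sum [seq fa_mul p.1 p.2 | p <- l])) => //.
  rewrite fa_sumE big_map; elim: l Hl {xl} => [|p l IH] Hl.
    by rewrite big_nil; exact: lpa_ideal0.
  rewrite big_cons; apply: lpa_idealD => //.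
    by case: (Hl p (or_introl erefl)) => Ap Bp; exact: ABC.
  by apply: IH => r rl; apply: Hl; right.
by rewrite -opprB; exact: relIN.
Qed.

Lemma ideal_pow_exp (P : FA -> Prop) x n : is_ideal P -> P x -> ideal_pow P n.+1 (x ^+ n.+1).
Proof.
move=> iP Px; have px := lpa_ideal_poly iP Px; have [fx _] := px.
elim: n => [|n IH]; first by rewrite expr1.
have fX : fin_supp (x ^+ n.+1).
  by elim: (n) => [|m IHm]; rewrite ?expr1 // exprS; exact: finM.
split; first by rewrite exprSr; exact: polyMl.
exists [:: (x ^+ n.+1, x)]; split=> [p [<-|//]|] //=.
rewrite /lpa_eq fa_subE.
have -> : fa_add (fa_mul (x ^+ n.+1) x) (@fa0 K E) = x ^+ n.+1 * x by exact: addr0.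
by rewrite [x ^+ n.+2]exprSr subrr; exact: relI0.
Qed.

Lemma ideal_pow_sub (P : FA -> Prop) n : is_ideal P -> sub_ideal (ideal_pow P n.+1) P.
Proof.
move=> iP; elim: n => [|n IH] //; apply: ideal_prod_sub => // x y /IH Px /(lpa_ideal_poly iP) py.
exact: (lpa_idealMr iP).
Qed.

Lemma lpa_idealI (A B : FA -> Prop) : is_ideal A -> is_ideal B -> is_ideal (fun x => A x /\ B x).
Proof.
move=> iA iB; split=> [x [/(lpa_ideal_poly iA)]//|].
split=> [x y [Ax Bx] py xy|].
  by split; [exact: (lpa_ideal_eq iA) xy | exact: (lpa_ideal_eq iB) xy].
split; first by split; [exact: (lpa_ideal0 iA) | exact: (lpa_ideal0 iB)].
split=> [x y [Ax Bx] [Ay By]|]; first by split; [exact: (lpa_idealD iA) | exact: (lpa_idealD iB)].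
split=> [x [Ax Bx]|x a [Ax Bx] pa]; first by split; [exact: (lpa_idealN iA) | exact: (lpa_idealN iB)].
by split; split;
  [exact: (lpa_idealMl iA) | exact: (lpa_idealMl iB) | exact: (lpa_idealMr iA) | exact: (lpa_idealMr iB)].
Qed.

(** If the intersection of A and B is P^n with P prime, then A B lies in P, so one of them, say A,
    does. For x in A the power x^n lies in P^n, hence in B. If the intersection is not proper, B is
    all of L. *)
Lemma prime_powers_comparable : all_proper_prime_power K E -> power_comparable K E.
Proof.
move=> H A B iA iB; have iAB := lpa_idealI iA iB.
have [pr|npr] := EM (proper (fun x => A x /\ B x)); last first.
  exists 1%N; split=> //; left=> x Ax; rewrite expr1; apply: contrapT => nBx.
  by apply: npr; exists x; split; [exact: lpa_ideal_poly iA _ Ax | case].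
have [P [n [[iP _ primeP] [n0 PE]]]] := H _ iAB pr.
case: n n0 PE => // n _ PE; exists n.+1; split=> //.
have prodP : sub_ideal (ideal_prod A B) P.
  move=> x ABx; apply: (@ideal_pow_sub P n) => //; apply/PE.
  split; move: x ABx; apply: ideal_prod_sub => // x y.
    by move=> Ax /(lpa_ideal_poly iB) py; exact: (lpa_idealMr iA).
  by move=> /(lpa_ideal_poly iA) px By; exact: (lpa_idealMl iB).
case: (primeP A B iA iB prodP) => [AP|BP]; [left=> x /AP | right=> x /BP] => Px.
  by case: (proj2 (PE _) (ideal_pow_exp n iP Px)).
by case: (proj2 (PE _) (ideal_pow_exp n iP Px)).
Qed.

Lemma primes_prime_powers : all_proper_prime K E -> all_proper_prime_power K E.
Proof. by move=> H J iJ pJ; exists J, 1%N; split; [exact: H | split]. Qed.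

Lemma condK_chain_total : condK_admissible_chain E -> forall A B : FA -> Prop,
  is_ideal A -> is_ideal B -> sub_ideal A B \/ sub_ideal B A.
Proof.
move=> [CK ch] A B iA iB.
have [le|le] := ch _ _ _ _ (ideal_admissible iA) (ideal_admissible iB).
  by left; exact: ideal_sub_of_le.
by right; exact: ideal_sub_of_le.
Qed.

Lemma condK_chain_graded : condK_admissible_chain E -> all_graded_chain K E.
Proof.
move=> CKch; split; last exact: condK_chain_total.
by move=> J iJ; apply: ideal_graded => //; case: CKch.
Qed.

(** If A is the smaller of the two ideals, idempotence gives that A lies in A B, hence in J;
    likewise for B. *)
Lemma condK_chain_prime : condK_admissible_chain E -> all_proper_prime K E.
Proof.
move=> CKch J iJ pJ; split=> // A B iA iB ABJ; have [CK _] := CKch.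
have [AB|BA] := condK_chain_total CKch iA iB; [left | right] => x xI; apply: ABJ.
  by apply: (sub_ideal_prod iA CK) => // y.
by apply: (sub_ideal_prod iB CK) => // y.
Qed.

End Equivalence.

Theorem theorem4p1 (K : fieldType) (E : graph) (hE : inhabited (vert E)) :
  (all_proper_prime K E <-> all_proper_prime_power K E) /\
  (all_proper_prime_power K E <-> all_graded_chain K E) /\
  (all_graded_chain K E <-> condK_admissible_chain E).
Proof.
(* The implications run from (1) to (2) to (4) and back to (1), while (3) and (4) imply each
   other. *)
have H12 := @primes_prime_powers K E.
have H24 H := comparable_condK_chain (@prime_powers_comparable K E H).
have H34 H := comparable_condK_chain (@chain_comparable K E H).
have H43 := @condK_chain_graded K E.
have H41 := @condK_chain_prime K E.
by split; [|split]; split=> //; [move=> /H24/H41 | move=> /H24/H43 | move=> /H34/H41/H12].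
Qed.
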